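(* Let $n\geq 5$ and let $q\colon B'_n\to G$ be a surjective group homomorphism onto a nontrivial group $G$. Then either $|G|>|A_n|=\frac{n!}{2}$, or $G$ is isomorphic to $A_n$. Moreover, in the latter case ($G\cong A_n$), the quotient map $q$ is obtained by postcomposing the natural map $\pi\colon B'_n\to A_n$ with an automorphism of $A_n$; that is, identifying $G$ with $A_n$ by an isomorphism, one has $q=\varphi\circ\pi$ for some $\varphi\in\operatorname{Aut}(A_n)$.
   Context: $B_n$ denotes the Artin braid group on $n$ strands, with standard generators $\sigma_1,\dots,\sigma_{n-1}$ and relations $\sigma_i\sigma_{i+1}\sigma_i=\sigma_{i+1}\sigma_i\sigma_{i+1}$ for $1\le i\le n-2$ and $\sigma_i\sigma_j=\sigma_j\sigma_i$ for $|i-j|\geq 2$. $B'_n=[B_n,B_n]$ is its commutator subgroup. $S_n$ and $A_n$ are the symmetric and alternating groups on $n$ letters. The standard projection $\pi\colon B_n\to S_n$ sends $\sigma_i$ to the transposition $(i\ \,i+1)$; it restricts to an epimorphism $\pi\colon B'_n\to A_n$, which is the natural map. The group $G$ is allowed to be infinite, in which case $|G|>\frac{n!}{2}$ holds. *)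

(* Defs.v *)
(* Groups are groupTypes, hence possibly infinite. The quotient and the
   subtype below use classical decidability of propositions. *)
From HB Require Import structures.
From mathcomp Require Import all_boot all_fingroup all_solvable.
From mathcomp Require classical_sets.
From mathcomp Require Import boolp cardinality.

Set Implicit Arguments.
Unset Strict Implicit.
Unset Printing Implicit Defensive.

Local Open Scope group_scope.

(* Homomorphisms between groupTypes; they come with f 1 = 1 and
   f (x * y) = f x * f y. *)
Notation group_hom := UMagmaMorphism.type.

Definition isomorphic (G H : groupType) : Prop :=
  exists f : group_hom G H, bijective f.

(* The group < X | u = v for rel u v >: words in the letters (x, true) for x
   and (x, false) for x^-1, modulo the least congruence cancelling
   x x^-1 and x^-1 x and containing rel. *)
Section Presentation.
Variables (X : choiceType) (rel : seq (X * bool) -> seq (X * bool) -> Prop).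

Inductive word_eq : seq (X * bool) -> seq (X * bool) -> Prop :=
| word_eq_refl u : word_eq u u
| word_eq_sym u v : word_eq u v -> word_eq v u
| word_eq_trans v u w : word_eq u v -> word_eq v w -> word_eq u w
| word_eq_cat u u' v v' :
    word_eq u u' -> word_eq v v' -> word_eq (u ++ v) (u' ++ v')
| word_eq_cancel x b : word_eq [:: (x, b); (x, ~~ b)] [::]
| word_eq_rel u v : rel u v -> word_eq u v.

Definition word_eqb (u v : seq (X * bool)) : bool := `[< word_eq u v >].

Lemma word_eqb_refl : reflexive word_eqb.
Proof. by move=> u; apply/asboolP/word_eq_refl. Qed.

Lemma word_eqb_sym : symmetric word_eqb.
Proof.
by move=> u v; apply/idP/idP => /asboolP uv; apply/asboolP/word_eq_sym.
Qed.

Lemma word_eqb_trans : transitive word_eqb.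
Proof.
move=> v u w /asboolP uv /asboolP vw.
by apply/asboolP; apply: word_eq_trans vw.
Qed.

Canonical word_equiv :=
  EquivRel word_eqb word_eqb_refl word_eqb_sym word_eqb_trans.

Definition presented := {eq_quot word_equiv}%qT.
HB.instance Definition _ := Choice.on presented.

Definition word_class (u : seq (X * bool)) : presented :=
  \pi_({eq_quot word_equiv})%qT u.
Definition word_repr (a : presented) : seq (X * bool) := generic_quotient.repr a.

Lemma word_reprK : cancel word_repr word_class.
Proof. exact: reprK. Qed.

Lemma word_classP u v : word_class u = word_class v <-> word_eq u v.
Proof.
by split=> [/eqP|uv]; [rewrite /word_class eqmodE => /asboolP
                     | apply/eqP; rewrite /word_class eqmodE; apply/asboolP].
Qed.

Lemma word_repr_class u : word_eq (word_repr (word_class u)) u.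
Proof. by apply/word_classP; rewrite word_reprK. Qed.

Definition word_inv (u : seq (X * bool)) := rev [seq (a.1, ~~ a.2) | a <- u].

Lemma word_inv_cons a u : word_inv (a :: u) = word_inv u ++ [:: (a.1, ~~ a.2)].
Proof. by rewrite /word_inv /= rev_cons cats1. Qed.

Lemma word_inv_cat u v : word_inv (u ++ v) = word_inv v ++ word_inv u.
Proof. by rewrite /word_inv map_cat rev_cat. Qed.

Lemma word_invK : involutive word_inv.
Proof.
elim=> [//|[x b] u IHu]; rewrite word_inv_cons word_inv_cat IHu /=.
by rewrite /word_inv /= negbK.
Qed.

Lemma word_mulwV u : word_eq (u ++ word_inv u) [::].
Proof.
elim: u => [|[x b] u IHu]; first exact: word_eq_refl.
have -> : ((x, b) :: u) ++ word_inv ((x, b) :: u) =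
    [:: (x, b)] ++ ((u ++ word_inv u) ++ [:: (x, ~~ b)]).
  by rewrite word_inv_cons /= catA.
apply: (word_eq_trans (v := [:: (x, b)] ++ ([::] ++ [:: (x, ~~ b)]))).
  apply: word_eq_cat; first exact: word_eq_refl.
  by apply: word_eq_cat; [exact: IHu | exact: word_eq_refl].
exact: word_eq_cancel.
Qed.

Lemma word_mulVw u : word_eq (word_inv u ++ u) [::].
Proof. by rewrite -{2}[u]word_invK; apply: word_mulwV. Qed.

Definition presented_mul (a b : presented) : presented :=
  word_class (word_repr a ++ word_repr b).
Definition presented_one : presented := word_class [::].
Definition presented_inv (a : presented) : presented :=
  word_class (word_inv (word_repr a)).

Lemma presented_mulA : associative presented_mul.
Proof.
move=> a b c; apply/word_classP.
apply: (word_eq_trans (v := word_repr a ++ word_repr b ++ word_repr c)).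
  by apply: word_eq_cat; [exact: word_eq_refl | exact: word_repr_class].
rewrite catA; apply: word_eq_cat; last exact: word_eq_refl.
exact/word_eq_sym/word_repr_class.
Qed.

Lemma presented_mul1g : left_id presented_one presented_mul.
Proof.
move=> a; rewrite -[RHS]word_reprK; apply/word_classP.
apply: (@word_eq_cat _ [::] _ (word_repr a)); last exact: word_eq_refl.
exact: word_repr_class.
Qed.

Lemma presented_mulg1 : right_id presented_one presented_mul.
Proof.
move=> a; rewrite -[RHS]word_reprK; apply/word_classP.
rewrite -[X in word_eq _ X]cats0.
by apply: word_eq_cat; [exact: word_eq_refl | exact: word_repr_class].
Qed.

Lemma presented_mulVg :
  left_inverse presented_one presented_inv presented_mul.
Proof.
move=> a; apply/word_classP.
apply: (word_eq_trans (v := word_inv (word_repr a) ++ word_repr a)).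
  by apply: word_eq_cat; [exact: word_repr_class | exact: word_eq_refl].
exact: word_mulVw.
Qed.

Lemma presented_mulgV :
  right_inverse presented_one presented_inv presented_mul.
Proof.
move=> a; apply/word_classP.
apply: (word_eq_trans (v := word_repr a ++ word_inv (word_repr a))).
  by apply: word_eq_cat; [exact: word_eq_refl | exact: word_repr_class].
exact: word_mulwV.
Qed.

HB.instance Definition _ := isGroup.Build presented presented_mulA
  presented_mul1g presented_mulg1 presented_mulVg presented_mulgV.

Definition presented_gen (x : X) : presented := word_class [:: (x, true)].

Section Evaluation.
Variables (H : groupType) (f : X -> H).

Definition word_eval (u : seq (X * bool)) : H :=
  \prod_(a <- u) (if a.2 then f a.1 else (f a.1)^-1).

Hypothesis f_rel : forall u v, rel u v -> word_eval u = word_eval v.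

Lemma word_eval_eq u v : word_eq u v -> word_eval u = word_eval v.
Proof.
elim=> {u v} // [v u w _ -> _ -> //|u u' v v' _ Eu _ Ev|x b].
  by rewrite /word_eval !big_cat -!/(word_eval _) Eu Ev.
rewrite /word_eval !big_cons big_nil mulg1 /=.
by case: b; rewrite /= ?mulgV ?mulVg.
Qed.
End Evaluation.

End Presentation.

(* The letter i : 'I_n.-1 is the generator crossing the
   strands i and i + 1, numbered from 0. *)
Inductive artin_rel (n : nat) :
  seq ('I_n.-1 * bool) -> seq ('I_n.-1 * bool) -> Prop :=
| artin_braid (i j : 'I_n.-1) : j = i.+1 :> nat ->
    artin_rel [:: (i, true); (j, true); (i, true)]
              [:: (j, true); (i, true); (j, true)]
| artin_comm (i j : 'I_n.-1) : (i.+2 <= j)%N || (j.+2 <= i)%N ->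
    artin_rel [:: (i, true); (j, true)] [:: (j, true); (i, true)].

Definition braid (n : nat) := presented (@artin_rel n).
HB.instance Definition _ n := Group.on (braid n).

Definition sigma (n : nat) (i : 'I_n.-1) : braid n :=
  presented_gen (@artin_rel n) i.

(* The commutator subgroup as a predicate on G; derived_of G is the same
   subgroup as a groupType. *)
Inductive in_derived (G : groupType) : G -> Prop :=
| in_derived1 : in_derived 1
| in_derivedR x y : in_derived [~ x, y]
| in_derivedM x y : in_derived x -> in_derived y -> in_derived (x * y)
| in_derivedV x : in_derived x -> in_derived x^-1.

Definition derived_pred (G : groupType) : pred G := fun x => `[< in_derived x >].

Record derived_of (G : groupType) := Derived {
  derived_val :> G;
  derived_valP : derived_pred derived_val }.

HB.instance Definition _ (G : groupType) := [isSub for @derived_val G].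
HB.instance Definition _ (G : groupType) := [Choice of derived_of G by <:].

Lemma derived_closed (G : groupType) : group_closed (@derived_pred G).
Proof.
split=> [|x y]; first exact/asboolP/in_derived1.
by move=> /asboolP Gx /asboolP Gy; apply/asboolP/in_derivedM/in_derivedV.
Qed.

HB.instance Definition _ (G : groupType) :=
  SubChoice_isSubGroup.Build G _ (derived_of G) (@derived_closed G).

Lemma derived_val1 (G : groupType) : derived_val (1 : derived_of G) = 1.
Proof. exact: val1. Qed.

Lemma derived_valM (G : groupType) :
  {morph @derived_val G : x y / x * y}.
Proof. exact: valM. Qed.

Definition braid' (n : nat) := derived_of (braid n).
HB.instance Definition _ n := Group.on (braid' n).

(* 'Alt_T is a set of permutations; this is the type of its elements, which
   is a group of its own. *)
Notation alternating n := (subg_of 'Alt_('I_n)).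

Section Projection.
Variable n : nat.

Lemma strand_ltn (i : 'I_n.-1) : (i.+1 < n)%N.
Proof. by case: i => i /=; case: n. Qed.

Definition transposition (i : 'I_n.-1) : 'S_n :=
  tperm (Ordinal (ltnW (strand_ltn i))) (Ordinal (strand_ltn i)).

Lemma transposition_rel u v : artin_rel u v ->
  word_eval transposition u = word_eval transposition v.
Proof.
rewrite /word_eval; case=> {u v} [i j ij|i j ij];
  rewrite !big_cons big_nil /= !mulg1 /transposition.
  have -> : Ordinal (ltnW (strand_ltn j)) = Ordinal (strand_ltn i).
    exact/val_inj.
  set a := Ordinal (ltnW _); set b := Ordinal _; set c := Ordinal _.
  have ab : a != b by rewrite -val_eqE /= neq_ltn ltnSn.
  have ac : a != c by rewrite -val_eqE /= ij neq_ltn ltnW.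
  have bc : b != c by rewrite -val_eqE /= ij neq_ltn ltnSn.
  have conj3 (x y : 'I_n) (t : 'S_n) : tperm x y * (t * tperm x y) = t ^ tperm x y.
    by rewrite conjgE tpermV.
  rewrite !conj3 !tpermJ tpermL tpermR (tpermD ac bc).
  by rewrite [tperm b c a]tpermD 1?eq_sym.
have far (k l : nat) : (k.+2 <= l)%N ->
    [&& k != l, k != l.+1, l != k & l != k.+1].
  move=> lt_k1l; have lt_kl := ltnW lt_k1l; have le_kl := ltnW lt_kl.
  rewrite (ltn_eqF lt_kl) (gtn_eqF lt_kl) (gtn_eqF lt_k1l).
  by rewrite (@ltn_eqF k l.+1).
have {far ij} [neq_ji neq_jSi neq_ij neq_iSj] :
    [/\ j != i :> nat, j != i.+1 :> nat, i != j :> nat & i != j.+1 :> nat].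
  by case/orP: ij => /far/and4P[].
apply/commgP/conjg_fixP; rewrite tpermJ.
by congr (tperm _ _); rewrite tpermD // -(inj_eq val_inj) //= eq_sym.
Qed.

(* Characterised by braid_perm_is_hom and braid_permP. *)
Definition braid_perm (b : braid n) : 'S_n :=
  word_eval transposition (word_repr b).

Lemma braid_perm_is_hom : monoid_morphism braid_perm.
Proof.
split=> [|a b]; rewrite /braid_perm.
  rewrite (word_eval_eq transposition_rel (word_repr_class _ _)).
  by rewrite /word_eval big_nil.
rewrite (word_eval_eq transposition_rel (word_repr_class _ _)).
by rewrite /word_eval big_cat.
Qed.

HB.instance Definition _ :=
  isUMagmaMorphism.Build (braid n) 'S_n braid_perm braid_perm_is_hom.

Lemma braid_permP (i : 'I_n.-1) : braid_perm (sigma i) = transposition i.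
Proof.
rewrite /braid_perm (word_eval_eq transposition_rel (word_repr_class _ _)).
by rewrite /word_eval big_cons big_nil mulg1.
Qed.

Lemma braid_perm_Alt (b : braid' n) : braid_perm (derived_val b) \in 'Alt_('I_n).
Proof.
case: b => b /= /asboolP; elim=> {b} [|x y|x y _ Ax _ Ay|x _ Ax].
- by rewrite gmulf1 group1.
- by rewrite Alt_even gmulfR commgEl !odd_permM !odd_permV;
    do 2 case: odd_perm.
- by rewrite gmulfM groupM.
- by rewrite gmulfV groupV.
Qed.

Definition natural_map (b : braid' n) : alternating n :=
  Subg (braid_perm_Alt b).

Lemma natural_map_is_hom : monoid_morphism natural_map.
Proof.
split=> [|a b]; apply: val_inj => /=.
  exact: gmulf1.
exact: gmulfM.
Qed.

HB.instance Definition _ := isUMagmaMorphism.Build (braid' n)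
  (alternating n) natural_map natural_map_is_hom.
End Projection.

(* |G| > m; true in particular when G is infinite. *)
Import classical_sets.
Definition card_gt (G : Type) (m : nat) : Prop :=
  (`I_m #<= [set: G]%classic)%card /\ (`I_m #!= [set: G]%classic)%card.

(* Main.v *)
Require Import Defs.
From HB Require Import structures.
From mathcomp Require Import all_boot all_fingroup all_solvable.
From mathcomp Require Import boolp cardinality zify.
From mathcomp Require classical_sets.

(** Write n = r + 3, let s_0, ..., s_(n-2) be the standard generators and let
    q be a surjection of B'_n onto G.  The group G is generated by the images
    v_k of s_0^k s_1 s_0^-(k+1) and X_j of s_(j+2) s_0^-1, for j < r.  The X_j
    satisfy Artin's relations, conjugation by any X_j with j > 0 shifts the
    sequence v by one step, and there are two more families of relations,
    which involve v alone and v and X_0 (see [braid'_relations]).  The proof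
    distinguishes whether X_0^2 is trivial in G.

    If X_0^2 = 1, then G is a quotient of A_n ([square_kernel]).  Let L be the
    largest normal subgroup of B_n that lies in B'_n and is killed by q.  An
    element of B'_n that is killed by q and commutes with some s_i lies in L,
    because B_n is generated by B'_n and s_i.  Hence s_2^2 s_0^-2 is in L, and
    conjugation in B_n shows that all the s_i^2 agree modulo L; their common
    value is central modulo L.  By Coxeter's presentation of S_n
    ([perm_kernel_squares]) the kernel of B_n -> S_n is generated by the
    conjugates of the s_i^2, so it is contained in L <s_0^2>.  Comparing
    exponent sums, its intersection with B'_n is contained in L.  Since A_n is
    simple and G is not trivial, the kernels of q and of the natural map
    coincide, which gives both the isomorphism and the automorphism.

    If X_0^2 <> 1, then G has more than n!/2 elements ([large_quotient]).
    This is shown by exhibiting enough cosets at each step of the chain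
    <X_k, ..., X_(r-1)> for k = r, ..., 1, then <v_0, X_1, ..., X_(r-1)>, the
    block, and finally G.  If two of the exhibited cosets were equal, the
    relations would force X_0^2 = 1 or put X_0 into the block.  The numbers of
    cosets are 4, 5, ..., r + 2 along the chain, then 4, then r + 3, so that
    there are at least (2/3) n! elements.  If X_0^3 =
      1 the first 4 drops to 3, but the last
    index is at least r + 4, and (3/4) (r+4)/(r+3) (2/3) n! still exceeds n!/2.

    The last step needs that X_0 is not in the block.  This holds if r > 2:
    otherwise X_0 would be in the subgroup generated by the v_k, which commutes
    with X_1 X_2^-1 ([block_proper]).  If r = 2 and X_0 is in the block, then
    the block is G.  In that case G has a central element z with
    v_0 v_3 = z X_1^6, which excludes that X_0 has order at most 6; so the
    centraliser of X_0 has at least 7 elements, X_0 has at least 9 conjugates,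
    and 63 > 5!/2 ([card_five_strands]). *)

Set Implicit Arguments.
Unset Strict Implicit.
Unset Printing Implicit Defensive.

Local Open Scope group_scope.

(** * Subgroups of possibly infinite groups *)

Section Subgroups.
Variable G : groupType.
Implicit Types (P Q : G -> Prop) (x y : G) (rs : seq G).

Definition gclosed P :=
  [/\ P 1, forall x y, P x -> P y -> P (x * y) & forall x, P x -> P x^-1].

Inductive span (S : G -> Prop) : G -> Prop :=
| span_gen x : S x -> span S x
| span1 : span S 1
| spanM x y : span S x -> span S y -> span S (x * y)
| spanV x : span S x -> span S x^-1.

Lemma span_closed S : gclosed (span S).
Proof. by split; [exact: span1 | exact: spanM | exact: spanV]. Qed.

Lemma span_min S P : gclosed P -> (forall x, S x -> P x) ->
  forall x, span S x -> P x.
Proof.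
move=> [P1 PM PV] SP x; elim=> {x} [x /SP //|//|x y _ Px _ Py|x _ Px].
  exact: PM.
exact: PV.
Qed.

Lemma gclosed_cancel P a x b : gclosed P -> P a -> P b ->
  P (a * x * b) -> P x.
Proof.
move=> [P1 PM PV] Pa Pb Paxb.
have -> : x = a^-1 * (a * x * b) * b^-1 by rewrite !gnorm.
exact: (PM) (PM _ _ (PV _ Pa) Paxb) (PV _ Pb).
Qed.

Lemma centraliser_closed x : gclosed (commute x).
Proof.
split; [exact: commute1 | exact: commuteM | exact: commuteV].
Qed.

Definition at_least P (N : nat) : Prop :=
  exists2 s : seq G, uniq s /\ (N <= size s)%N & forall x, x \in s -> P x.

(** Pairwise distinct right cosets P r; the recursion makes a concrete list
    unfold to one goal for each pair. *)
Fixpoint apart P rs : Prop :=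
  if rs is r :: rs' then
    (forall r', r' \in rs' -> ~ P (r' * r^-1)) /\ apart P rs'
  else True.

Lemma apart_eq P rs : gclosed P -> apart P rs ->
  {in rs &, forall r r', P (r' * r^-1) -> r = r'}.
Proof.
move=> [P1 PM PV]; elim: rs => //= r0 rs IHrs [r0P rsP] r r'.
rewrite !inE => /predU1P[->|rs_r] /predU1P[->|rs_r'] Prr' //.
- by case: (r0P _ rs_r').
- by case: (r0P _ rs_r); rewrite -invgF; apply: PV.
- exact: IHrs.
Qed.

Lemma apart_uniq P rs : P 1 -> apart P rs -> uniq rs.
Proof.
move=> P1; elim: rs => //= r rs IHrs [rP /IHrs->]; rewrite andbT.
by apply/negP => /rP; rewrite mulgV.
Qed.

Lemma apart_iota P (f : nat -> G) a m :
  (forall i j, (a <= i < j)%N -> (j < a + m)%N -> ~ P (f j * (f i)^-1)) ->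
  apart P [seq f i | i <- iota a m].
Proof.
elim: m a => //= m IHm a fP; split; last first.
  by apply: IHm => i j ij jm; apply: fP; lia.
by move=> _ /mapP[j + ->]; rewrite mem_iota => jm; apply: fP; lia.
Qed.

(** Lagrange's theorem, as the inequality that survives in infinite groups. *)
Lemma at_least_cosets P Q N rs : gclosed P -> gclosed Q ->
    (forall x, P x -> Q x) -> (forall r, r \in rs -> Q r) ->
  apart P rs -> at_least P N -> at_least Q (N * size rs).
Proof.
move=> clP [_ QM _] PQ rsQ aP [s [Us leN] sP].
have [P1 PM PV] := clP.
exists [seq x * r | x <- s, r <- rs]; last first.
  by move=> _ /allpairsP[[x r] /= [/sP/PQ Qx /rsQ Qr ->]]; apply: QM.
split; last by rewrite size_allpairs leq_mul2r leN orbT.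
apply: allpairs_uniq => //; first exact: apart_uniq aP.
move=> _ _ /allpairsP[[x r] /= [sx rsr ->]] /allpairsP[[x' r'] /= [sx' rsr'
  ->]].
rewrite /= => xr; have Er : r = r'.
  apply: (apart_eq clP aP) => //.
  have -> : r' * r^-1 = x'^-1 * x by apply: (mulgI x');
    rewrite mulgA -xr !gnorm.
  by apply: (PM); [apply: (PV)|]; apply: sP.
by move: xr; rewrite Er => /mulIg->.
Qed.

End Subgroups.

(** * Consequences of the braid relations *)

Lemma eq_by_relation (G : groupType) (u l r L R : G) :
  l = r -> u^-1 * L * R^-1 * u = l * r^-1 -> L = R.
Proof.
move=> -> /eqP; rewrite mulgV => /eqP uLR; apply: divg1_eq.
have -> : L * R^-1 = u * (u^-1 * L * R^-1 * u) * u^-1 by rewrite !gnorm.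
by rewrite uLR !gnorm.
Qed.

(** Most identities below follow from a single relation l = r: some conjugate of
    the relator l r^-1 is freely equal to L R^-1. Since [gnorm] decides equality
    in the free group, only the conjugator u has to be given. *)
Ltac by_relation u E := apply: (eq_by_relation (u := u) E); by rewrite !gnorm.

Section BraidPair.
Variables (G : groupType) (a b : G).
Hypothesis ab : a * b * a = b * a * b.

Lemma braid_conj : (a * b) * a * (a * b)^-1 = b.
Proof. by rewrite ab !gnorm. Qed.

(** Conjugation by a b takes a to b; it fixes a^k as soon as a^k commutes with
    b. *)
Lemma braid_commuteX k : commute (a ^+ k) b -> a ^+ k = b ^+ k.
Proof.
move=> cab; rewrite -[in RHS]braid_conj.
have -> : a * b * a * (a * b)^-1 = a ^ (a * b)^-1.
  by rewrite conjgE !gnorm.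
rewrite -conjXg; apply/esym/conjg_fixP/commgP/commuteV/commuteM => //.
exact/commute_sym/commuteX.
Qed.

Lemma braid_swapV : a^-1 * b * a = b * a * b^-1.
Proof. by apply: (mulgI a); apply: (mulIg b); rewrite !gnorm -ab. Qed.

Lemma braid_swap : a * b * a^-1 = b^-1 * a * b.
Proof. by apply: (mulgI b); apply: (mulIg a); rewrite !gnorm -ab. Qed.

End BraidPair.

Section BraidTriple.
Variables (G : groupType) (a b c : G).
Hypotheses (ab : a * b * a = b * a * b) (bc : b * c * b = c * b * c).
Hypothesis ac : commute a c.

Lemma braid3_swap : (b * a * c * b) * a = c * (b * a * c * b).
Proof.
have -> : b * a * c * b * a = b * c * (a * b * a).
  by rewrite -(mulgA b a c) ac !gnorm.
have -> : b * c * (a * b * a) = b * c * b * (a * b) by rewrite ab !gnorm.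
by rewrite bc -(mulgA (c * b) c) (mulgA c a b) -ac !gnorm.
Qed.

Lemma braid3_swap' : (b * a * c * b) * c = a * (b * a * c * b).
Proof.
have -> : b * a * c * b * c = b * a * (b * c * b) by rewrite bc !gnorm.
by rewrite !mulgA -ab.
Qed.

Lemma braid3_square_commute :
  commute a (b * c * c * b) -> commute b (a * a * (c * c)^-1).
Proof.
move=> aw.
have E1 : b^-1 * a * b * (c * c) = c * c * (b * a * b^-1).
  by_relation (b^-1) aw.
rewrite -(braid_swap ab) -(braid_swapV ab) in E1.
have cca : a * (c * c) = c * c * a by apply: commuteM.
have E2 : a * a * b * c * c = a * (a * b * a^-1 * (c * c)) * a.
  by_relation (a * a * b * a^-1) cca.
have E3 : a * (c * c * (a^-1 * b * a)) * a = c * c * b * a * a.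
  by_relation (1 : G) cca.
have E4 : a * a * b * c * c = c * c * b * a * a by rewrite E2 E1 E3.
have cca2 : a * a * (c * c)^-1 = (c * c)^-1 * (a * a).
  exact/commuteV/commute_sym/commuteM/commute_sym.
have E5 : b * (a * a * (c * c)^-1) = b * ((c * c)^-1 * (a * a)) by rewrite cca2.
have E6 : (c * c)^-1 * (a * a) * b = b * (a * a * (c * c)^-1).
  by_relation ((c * c)^-1) E4.
by rewrite /commute -E6 cca2.
Qed.

(** The element t = a^2 c^-2 commutes with a and c, and with b by the previous
    lemma, hence with b a c b. But b a c b exchanges a and c, hence inverts t.
    So t^2 = 1. *)
Lemma braid3_exp4 : commute a (b * c * c * b) -> a ^+ 4 = c ^+ 4.
Proof.
move=> aw; pose t := a * a * (c * c)^-1.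
have tb : commute t b by apply/commute_sym/braid3_square_commute.
have ta : commute t a.
  by apply/commute_sym; do ?[apply: commuteM | apply: commuteV].
have tc : commute t c.
  by apply/commute_sym; do ?[apply: commuteM | apply: commuteV];
    apply/commute_sym.
pose s := b * a * c * b.
have ts : t * s = s * t by do ?apply: commuteM.
have sa : s * a = c * s := braid3_swap.
have sc : s * c = a * s := braid3_swap'.
clearbody s.
have st : s * t = t^-1 * s.
  have -> : s * t = s * a * a * (c^-1 * c^-1) by rewrite /t !gnorm.
  have -> : t^-1 * s = c * c * a^-1 * a^-1 * s by rewrite /t !gnorm.
  rewrite sa -(mulgA c) sa -!mulgA; congr (c * (c * _)).
  have scV : s * c^-1 = a^-1 * s by by_relation (a^-1) (esym sc).
  by rewrite (mulgA s) scV -mulgA scV.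
have t2 : t * t = 1.
  by apply: (mulIg s); rewrite -mulgA ts st !gnorm.
have cca : commute (a * a) (c * c)^-1.
  by apply/commuteV/commute_sym/commuteM; apply/commute_sym/commuteM.
have E : a * a * (a * a) * (c * c * (c * c))^-1 = t * t.
  by by_relation (a * a) cca.
by apply: divg1_eq; rewrite -t2 -E !expgS !mulg1 !gnorm.
Qed.

End BraidTriple.

(** * The relations in a quotient of the commutator subgroup *)

Section Relations.
Variables (G : groupType) (r : nat) (v X : nat -> G).

Record artin_relations : Prop := {
  rel_braid j : (j.+1 < r)%N -> X j * X j.+1 * X j = X j.+1 * X j * X j.+1;
  rel_comm i j : (i.+1 < j < r)%N -> commute (X i) (X j) }.

(** Relations between the images v_k of s_0^k s_1 s_0^-(k+1) and X_j of s_(j+2)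
    s_0^-1. *)
Record braid'_relations : Prop := {
  rel_artin :> artin_relations;
  rel_vv k : v k.+1 = v k * v k.+2;
  rel_vX0 k : v k * X 0 * v k.+2 = X 0 * v k.+1 * X 0;
  rel_vX k j : (0 < j < r)%N -> v k * X j = X j * v k.+1 }.

Hypotheses (r_gt1 : (1 < r)%N) (rel : braid'_relations).

Lemma vSS k : v k.+2 = (v k)^-1 * v k.+1.
Proof. by rewrite (rel_vv rel k) !gnorm. Qed.

Lemma vV k : v k = v k.+1 * (v k.+2)^-1.
Proof. by rewrite (rel_vv rel k) !gnorm. Qed.

Lemma vconj k j : (0 < j < r)%N -> v k.+1 = (X j)^-1 * v k * X j.
Proof. by move=> jr; rewrite -mulgA (rel_vX rel) // !gnorm. Qed.

Lemma vconjV k j : (0 < j < r)%N -> v k = X j * v k.+1 * (X j)^-1.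
Proof. by move=> jr; rewrite -(rel_vX rel) // !gnorm. Qed.

Lemma X0conjV k : (X 0)^-1 * v k * X 0 = v k.+1 * X 0 * (v k.+2)^-1.
Proof.
by apply: (mulIg (v k.+2)); rewrite -!mulgA mulVg mulg1 !mulgA
  -(mulgA _ (v k)) -(mulgA _ (v k * _)) (rel_vX0 rel) !gnorm.
Qed.

Lemma X0conj k : X 0 * v k.+2 * (X 0)^-1 = (v k)^-1 * X 0 * v k.+1.
Proof.
apply: (mulIg (X 0)); rewrite -!mulgA mulVg mulg1 (mulgA (X 0) (v k.+1)).
by rewrite -(rel_vX0 rel) !gnorm.
Qed.

Lemma closed_v P : gclosed P -> P (v 0) -> P (X 1) -> forall k, P (v k).
Proof.
move=> [P1 PM PV] Pv PX; elim=> // k Pvk.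
rewrite (@vconj k 1) //; exact: (PM) (PM _ _ (PV _ PX) Pvk) PX.
Qed.

(** The recursion v_k = v_(k+1) v_(k+2)^-1 runs downwards. *)
Lemma closed_v_tail P m : gclosed P -> (forall k, (m <= k)%N -> P (v k)) ->
  forall k, P (v k).
Proof.
move=> [P1 PM PV]; elim: m => [|m IHm] Pv k; first exact: Pv.
apply: IHm => {}k; rewrite leq_eqVlt => /predU1P[<-|/Pv//].
by rewrite vV; apply: (PM); [|apply: (PV)]; apply: Pv; rewrite ?leqnSn.
Qed.

Local Notation x := (X 0).

(** The subgroup generated by x and z_0 is normalised by every v_k, and the
    action is explicit: see [zS], [v_act_x] and [v_act_z]. This is how the
    lemmas below compute. The definition is locked so that normalising a word
    does not unfold it. *)
Definition z k := locked (v k * x^-1 * (v k)^-1).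

Lemma zE k : z k = v k * x^-1 * (v k)^-1.
Proof. by rewrite /z -lock. Qed.

Lemma zS k : z k.+1 = z k * x.
Proof.
have E : x * v k.+1 * x = v k * x * ((v k)^-1 * v k.+1).
  by rewrite -vSS (rel_vX0 rel).
by rewrite !zE; by_relation (v k * x^-1 * (v k)^-1) (esym E).
Qed.

Lemma zD k i : z (k + i) = z k * x ^+ i.
Proof.
elim: i => [|i IHi]; first by rewrite addn0 mulg1.
by rewrite addnS zS IHi expgSr mulgA.
Qed.

Lemma v_act_x k : v k * x * (v k)^-1 = (z k)^-1.
Proof. by rewrite !zE !gnorm. Qed.

Lemma v_act_z k : v k * z k * (v k)^-1 = z k * x * z k * z k.
Proof.
have E : z k.+1 = v k * z k.+2 * (v k)^-1 by rewrite !zE (rel_vv rel k) !gnorm.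
have {}E : z k * x = v k * z k * (v k)^-1 * (v k * x * (v k)^-1)
                 * (v k * x * (v k)^-1).
  by rewrite -zS E !zS !gnorm.
by rewrite !v_act_x in E; rewrite E !gnorm.
Qed.

(** Conjugation by X_j^-i takes z_0 to z_i = z_0 x^i if X_j^i commutes with x.
    If X_j^i = x^i, then x^-i z_0 x^i = z_0 x^i, whence x^i = 1. *)
Lemma exp_eq_trivial i j : (0 < j < r)%N -> x ^+ i = X j ^+ i -> x ^+ i = 1.
Proof.
move=> jr E; have vi : forall k, (X j ^+ k)^-1 * v 0 * X j ^+ k = v k.
  elim=> [|k IHk]; first by rewrite !gnorm.
  by rewrite (vconj _ jr) -IHk expgSr !gnorm.
have : (x ^+ i)^-1 * z 0 * x ^+ i = z 0 * x ^+ i.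
  rewrite -zD add0n.
  have -> : z i = (X j ^+ i)^-1 * v 0 * (X j ^+ i * x^-1 * (X j ^+ i)^-1)
                    * (v 0)^-1 * X j ^+ i by rewrite zE -vi !gnorm.
  have xc : commute (X j ^+ i) x^-1.
    by rewrite -E; apply/commuteV/commute_sym/commuteX.
  by rewrite xc zE E !gnorm.
move/mulIg; rewrite -[RHS]mul1g => /mulIg E1.
by rewrite -[x ^+ i]invgK E1 invg1.
Qed.

(** Going down along the chain: X_(k+1)^i = X_(k+2)^i commutes with X_k, because
    X_(k+2) does, so it equals X_k^i. *)
Lemma expX_eq_trivial k i : (k.+1 < r)%N -> X k ^+ i = X k.+1 ^+ i -> x ^+ i =
  1.
Proof.
elim: k => [|k IHk] kr E; first exact: (@exp_eq_trivial i 1).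
have kr' : (k.+1 < r)%N by apply: ltnW.
apply: IHk => //; apply/esym/braid_commuteX; first by rewrite -(rel_braid rel).
by rewrite E; apply/commute_sym/commuteX/(rel_comm rel); rewrite ltnSn.
Qed.

Lemma commuteX_trivial k i : (k.+1 < r)%N ->
  commute (X k ^+ i) (X k.+1) -> x ^+ i = 1.
Proof.
by move=> kr c; apply: (expX_eq_trivial kr); apply: braid_commuteX c;
  apply: (rel_braid rel).
Qed.

Lemma commuteX_trivial' k i : (k.+1 < r)%N ->
  commute (X k) (X k.+1 ^+ i) -> x ^+ i = 1.
Proof.
move=> kr c; apply: (expX_eq_trivial kr); apply/esym/braid_commuteX.
  by rewrite -(rel_braid rel).
exact: commute_sym.
Qed.

(** [braid3_exp4] gives X_k^4 = X_(k+2)^4, which commutes with X_(k-1) if k > 0.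
    *)
Lemma X_loop_exp4 k : (k.+2 < r)%N ->
  commute (X k) (X k.+1 * X k.+2 * X k.+2 * X k.+1) -> x ^+ 4 = 1.
Proof.
move=> kr c.
have E : X k ^+ 4 = X k.+2 ^+ 4.
  apply: (braid3_exp4 (b := X k.+1)) => //; first exact/(rel_braid rel)/ltnW.
    exact: (rel_braid rel).
  by apply: (rel_comm rel); rewrite ltnSn.
case: k => [|k] in kr c E *; first exact: (@exp_eq_trivial 4 2).
apply: (@commuteX_trivial' k); first by do 2 apply: ltnW.
by rewrite E; apply/commuteX/(rel_comm rel); rewrite leqnSn.
Qed.

Local Notation w := (v 0 * v 3).

Lemma w_act_x : w * x * w^-1 = z 0 * x^-1 * (z 0)^-1.
Proof.
have -> : w * x * w^-1 = v 0 * (z 3)^-1 * (v 0)^-1 by rewrite !zE !gnorm.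
have -> : v 0 * (z 3)^-1 * (v 0)^-1 =
    ((v 0 * z 0 * (v 0)^-1) * (v 0 * x * (v 0)^-1) * (v 0 * x * (v 0)^-1)
       * (v 0 * x * (v 0)^-1))^-1 by rewrite !zS !gnorm.
by rewrite v_act_x v_act_z !gnorm.
Qed.

(** If w and x commute, then z_0 inverts x, and applying v_0 to this gives z_0^2
    = x^-2. So conjugation by z_0 both inverts and fixes x^2. *)
Lemma w_commute_exp4 : commute x w -> x ^+ 4 = 1.
Proof.
move=> cw; have zx : z 0 * x * (z 0)^-1 = x^-1.
  have := w_act_x; rewrite -cw !gnorm => E.
  by rewrite {2}E !gnorm.
have z2 : z 0 * z 0 = x^-1 * x^-1.
  have E : v 0 * (z 0 * x * (z 0)^-1) * (v 0)^-1 = z 0.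
    by rewrite zx zE.
  have {E} : (v 0 * z 0 * (v 0)^-1) * (v 0 * x * (v 0)^-1)
             * (v 0 * z 0 * (v 0)^-1)^-1 = z 0 by rewrite -{3}E !gnorm.
  rewrite v_act_x v_act_z => E.
  have {}E : z 0 * x * (z 0)^-1 * x^-1 * (z 0)^-1 = z 0 by rewrite -{4}E !gnorm.
  by rewrite zx in E; rewrite -{1}E !gnorm.
have zx2 : z 0 * (x * x) * (z 0)^-1 = x^-1 * x^-1.
  by rewrite -[in RHS]zx !gnorm.
have E : x * x = x^-1 * x^-1.
  rewrite -zx2.
  have -> : x * x = (z 0 * z 0)^-1 by rewrite z2 !gnorm.
  by rewrite !gnorm.
by rewrite !expgS mulg1 mulgA {1}E !gnorm.
Qed.

(** If v_k and v_(k+1) commute, then v_k z_(k+1) v_k^-1 and v_(k+1) z_k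
    v_(k+1)^-1 are the same conjugate of x^-1. This amounts to x^-1 z_k =
    z_(k+1)^3. The instances k = 0 and k = 1 give z_2^2 = 1, and z_2 is a
    conjugate of x^-1. *)
Lemma v_commute_exp2 : commute (v 0) (v 1) -> x ^+ 2 = 1.
Proof.
have step k : commute (v k) (v k.+1) ->
    x^-1 * z k = z k.+1 * z k.+1 * z k.+1.
  move=> cv.
  have E : v k * z k.+1 * (v k)^-1 = v k.+1 * z k * (v k.+1)^-1.
    have -> : v k * z k.+1 * (v k)^-1 =
      (v k * v k.+1) * x^-1 * (v k * v k.+1)^-1 by rewrite !zE !gnorm.
    by rewrite cv !zE !gnorm.
  have E1 : v k * z k.+1 * (v k)^-1 = z k * x * z k.
    have -> : v k * z k.+1 * (v k)^-1 = (v k * z k * (v k)^-1)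
      * (v k * x * (v k)^-1) by rewrite zS !gnorm.
    by rewrite v_act_z v_act_x !gnorm.
  have E2 : v k.+1 * z k * (v k.+1)^-1 =
      z k.+1 * x * z k.+1 * z k.+1 * z k.+1.
    have -> : z k = z k.+1 * x^-1 by rewrite zS !gnorm.
    have -> : v k.+1 * (z k.+1 * x^-1) * (v k.+1)^-1 =
      (v k.+1 * z k.+1 * (v k.+1)^-1) * (v k.+1 * x * (v k.+1)^-1)^-1.
      by rewrite !gnorm.
    by rewrite v_act_z v_act_x !gnorm.
  rewrite E1 E2 in E; apply: (mulgI (z k * x * x)).
  by rewrite [RHS]mulgA; have := E; rewrite {1}zS !gnorm => ->.
move=> c01; have c12 : commute (v 1) (v 2).
  by rewrite vSS; apply: commuteM => //; apply/commuteV/commute_sym.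
have {c01}E0 := step 0%N c01; have {c12}E1 := step 1%N c12.
have m2 : z 2 * z 2 = 1.
  have z1 : z 1 = z 2 * x^-1 by rewrite (zS 1%N) !gnorm.
  have z0 : z 0 = z 2 * x^-1 * x^-1 by rewrite -z1 (zS 0%N) !gnorm.
  rewrite z0 z1 in E0; rewrite z1 in E1.
  apply: (mulgI (z 2 * z 2 * z 2)); rewrite mulg1; apply: (mulIg x^-1).
  have -> : z 2 * z 2 * z 2 * x^-1 = x^-1 * (z 2 * x^-1) * x^-1.
    by rewrite E1.
  have -> : x^-1 * (z 2 * x^-1) * x^-1 = x^-1 * (z 2 * x^-1 * x^-1).
    by rewrite !gnorm.
  rewrite E0.
  have -> : z 2 * x^-1 * (z 2 * x^-1) * (z 2 * x^-1) =
    z 2 * (x^-1 * (z 2 * x^-1)) * (z 2 * x^-1) by rewrite !gnorm.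
  by rewrite E1 !gnorm.
rewrite -[x]invgK expVgn.
have -> : x^-1 = (v 2)^-1 * z 2 * v 2 by rewrite !zE !gnorm.
by apply: invg_inj; rewrite invgK invg1 expg2; by_relation ((v 2)^-1) m2.
Qed.

Lemma swap_inverts : (v 0 * x * v 3) * x * (v 0 * x * v 3)^-1 = x^-1.
Proof.
have -> : (v 0 * x * v 3) * x * (v 0 * x * v 3)^-1 =
    (v 0 * x * (v 0)^-1) * (v 0 * (z 3)^-1 * (v 0)^-1) * (v 0 * x * (v
        0)^-1)^-1.
  by rewrite !zE !gnorm.
have -> : v 0 * (z 3)^-1 * (v 0)^-1 =
    ((v 0 * z 0 * (v 0)^-1) * (v 0 * x * (v 0)^-1) * (v 0 * x * (v 0)^-1)
       * (v 0 * x * (v 0)^-1))^-1 by rewrite !zS !gnorm.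
by rewrite v_act_x v_act_z !gnorm.
Qed.

(** The braid relation of type B. *)
Lemma loops_commute : x * w * x * w = w * x * w * x.
Proof.
pose q := z 0 * x * (z 0)^-1.
have wz : w * z 0 * w^-1 = q * (z 0)^-1 * q * q * q * q * q.
  have -> : w * z 0 * w^-1 = v 0 * (v 3 * z 3 * (v 3)^-1) *
     (v 3 * x * (v 3)^-1)^-1 * (v 3 * x * (v 3)^-1)^-1
     * (v 3 * x * (v 3)^-1)^-1 * (v 0)^-1 by rewrite !zS !gnorm.
  rewrite v_act_z v_act_x invgK.
  have z3 : v 0 * z 3 * (v 0)^-1 = q.
    have -> : v 0 * z 3 * (v 0)^-1 = (w * x * w^-1)^-1 by rewrite !zE !gnorm.
    by rewrite w_act_x /q !gnorm.
  have -> : v 0 * (z 3 * x * z 3 * z 3) * z 3 * z 3 * z 3 * (v 0)^-1 =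
    (v 0 * z 3 * (v 0)^-1) * (v 0 * x * (v 0)^-1) * (v 0 * z 3 * (v 0)^-1)
    * (v 0 * z 3 * (v 0)^-1) * (v 0 * z 3 * (v 0)^-1) * (v 0 * z 3 * (v 0)^-1)
    * (v 0 * z 3 * (v 0)^-1) by rewrite !gnorm.
  by rewrite z3 v_act_x.
have wx : w * x * w^-1 = q^-1 by rewrite w_act_x /q !gnorm.
have wwx : w * q^-1 * w^-1 = q * x * q^-1.
  have -> : w * q^-1 * w^-1 =
    (w * z 0 * w^-1) * (w * x * w^-1)^-1 * (w * z 0 * w^-1)^-1.
    by rewrite /q !gnorm.
  by rewrite wz wx /q !gnorm.
have -> : x * w * x * w = x * (w * x * w^-1) * w * w by rewrite !gnorm.
have -> : w * x * w * x = (w * x * w^-1) * (w * (w * x * w^-1) * w^-1) * w * w.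
  by rewrite !gnorm.
by rewrite wx wwx !gnorm.
Qed.

End Relations.

(** * Products of consecutive generators *)

Section Runs.
Variables (G : groupType) (r : nat) (X : nat -> G).
Hypothesis rel : artin_relations r X.

Fixpoint run k l : G := if l is l'.+1 then run k l' * X (k + l') else 1.

Lemma run_cons k l : run k l.+1 = X k * run k.+1 l.
Proof.
elim: l => [|l IHl]; first by rewrite /= addn0 mulg1 mul1g.
have -> : run k l.+2 = run k l.+1 * X (k + l.+1) by [].
have -> : run k.+1 l.+1 = run k.+1 l * X (k.+1 + l) by [].
by rewrite IHl addSnnS mulgA.
Qed.

Lemma run_cat k l m : run k (l + m) = run k l * run (k + l) m.
Proof.
elim: m => [|m IHm]; first by rewrite addn0 mulg1.
by rewrite addnS /= IHm addnA mulgA.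
Qed.

Lemma run_commute i k l : (k + l <= r)%N ->
  (forall j, (k <= j < k + l)%N -> commute (X i) (X j)) ->
  commute (X i) (run k l).
Proof.
elim: l => [|l IHl] lr c /=; first exact: commute1.
by apply: commuteM; [apply: IHl => [|j jl]; [|apply: c]|apply: c]; lia.
Qed.

Lemma run_commute_run k l k' l' :
  (k + l < k')%N -> (k' + l' <= r)%N -> commute (run k l) (run k' l').
Proof.
move=> kk' lr; apply/commute_sym.
elim: l => [|l IHl] /= in kk' *; first exact: commute1.
apply: commuteM; first by apply: IHl; lia.
apply/commute_sym/run_commute => // j jl; apply: (rel_comm rel); lia.
Qed.

Lemma run_shift k l i : (k <= i < k + l)%N -> (k + l < r)%N ->
  run k l.+1 * X i = X i.+1 * run k l.+1.
Proof.
elim: l => [|l IHl] il lr; first by lia.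
have -> : run k l.+2 = run k l.+1 * X (k + l.+1) by [].
have [il'|li] := ltnP i (k + l).
  have -> : run k l.+1 * X (k + l.+1) * X i = run k l.+1 * X i * X (k + l.+1).
    by rewrite -!mulgA (rel_comm rel (i := i)) //; lia.
  by rewrite IHl ?mulgA //; lia.
have {li}-> : i = (k + l)%N by lia.
rewrite addnS /= -!mulgA (mulgA (X (k + l)) (X (k + l).+1)).
rewrite (rel_braid rel); last by lia.
rewrite !mulgA; congr (_ * _ * _); apply/commute_sym/run_commute; first by lia.
by move=> j jl; apply/commute_sym/(rel_comm rel); lia.
Qed.

Lemma run_shift_run k l m : (m <= l)%N -> (k + l < r)%N ->
  run k l.+1 * run k m = run k.+1 m * run k l.+1.
Proof.
move=> + lr; elim: m => [|m IHm] ml; first by rewrite mul1g mulg1.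
rewrite [run k m.+1]/= [run k.+1 m.+1]/= mulgA IHm; last by lia.
by rewrite -mulgA run_shift ?mulgA ?addSn //; lia.
Qed.

Lemma run_conj k l : (k + l < r)%N ->
  run k l * X (k + l) * (run k l)^-1 = (run k.+1 l)^-1 * X k * run k.+1 l.
Proof.
move=> lr; have E := run_shift_run (leqnn l) lr.
rewrite {1}run_cons [run k l.+1]/= in E.
by_relation ((run k.+1 l)^-1) (esym E).
Qed.

Variables (P : G -> Prop) (k : nat).
Hypotheses (clP : gclosed P) (PX : forall j, (k < j < r)%N -> P (X j)).
Hypothesis nPX : ~ P (X k).

Lemma closed_run k' l : (k < k')%N -> (k' + l <= r)%N -> P (run k' l).
Proof.
have [P1 PM _] := clP.
by move=> kk'; elim: l => //= l IHl lr; apply: (PM); [apply: IHl|apply: PX];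
  lia.
Qed.

(** The quotient of two runs is X_k between elements of P. Hence runs of
    different lengths that start at X_k are in different cosets of a subgroup P
    that contains the later generators but not X_k. *)
Lemma runs_apart l l' : (l < l')%N -> (k + l' <= r)%N ->
  ~ P (run k l' * (run k l)^-1).
Proof.
move=> ll' lr.
have -> : l' = (l.+1 + (l' - l.+1))%N by lia.
rewrite run_cat [run k l.+1]/=; set t := run (k + l.+1) _.
have ct : commute (run k l) t by apply: run_commute_run; lia.
have Pt : P t by apply: closed_run; lia.
have Pm : P (run k.+1 l) by apply: closed_run; lia.
have -> : run k l * X (k + l) * t * (run k l)^-1 =
   (run k.+1 l)^-1 * X k * (run k.+1 l * t).
  rewrite mulgA -run_conj; last by lia.
  by rewrite -!mulgA -(commuteV (commute_sym ct)).
have [_ PM PV] := clP.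
by move/(gclosed_cancel clP (PV _ Pm) (PM _ _ Pm Pt)).
Qed.

End Runs.

(** * The chain of subgroups generated by the last generators *)

Section Chain.
Variables (G : groupType) (r : nat) (v X : nat -> G).
Hypotheses (r_gt1 : (1 < r)%N) (rel : braid'_relations r v X).
Local Notation x := (X 0).
Local Notation run := (run X).
Hypothesis x2 : x ^+ 2 <> 1.

Lemma X0_neq1 : x <> 1.
Proof. by move=> x_1; apply: x2; rewrite x_1 expg1n. Qed.

Definition tail k := span (fun g => exists2 j, (k <= j < r)%N & g = X j).

Lemma tail_gen k j : (k <= j < r)%N -> tail k (X j).
Proof. by move=> kj; apply: span_gen; exists j. Qed.

Lemma tail_commute k i : (k.+1 < i)%N -> forall g, tail i g -> commute (X k) g.
Proof.
move=> ki; apply: span_min; first exact: centraliser_closed.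
by move=> _ [j ij ->]; apply: (rel_comm rel); lia.
Qed.

Lemma tail_sub k : forall g, tail k.+1 g -> tail k g.
Proof.
apply: span_min; first exact: span_closed.
by move=> _ [j jk ->]; apply: tail_gen; lia.
Qed.

(** Elements of <X_(k+1), ...> commute with X_(k-1). *)
Lemma expX_notin_tail k i : (0 < k < r)%N -> tail k.+1 (X k ^+ i) -> x ^+ i = 1.
Proof.
case: k => // k /= kr /(tail_commute (ltnSn _)).
exact: (commuteX_trivial' rel kr).
Qed.

(** One step of the chain: P is a subgroup that contains the generators after
    X_k, but not X_k. Apart from the runs of length at least 2, there are cosets
    represented by words in X_k and X_(k+1) alone. *)
Section Level.
Variables (P : G -> Prop) (k : nat).
Hypotheses (clP : gclosed P) (PX : forall j, (k < j < r)%N -> P (X j)).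
Hypothesis nPX : ~ P (X k).

Definition long_runs := [seq run k l | l <- iota 2 (r - k).-1].

Lemma long_runs_apart : (k < r)%N -> apart P long_runs.
Proof.
move=> kr; apply: apart_iota => i j ij jm.
by apply: (runs_apart rel clP PX nPX); lia.
Qed.

Lemma long_runsP g : (k < r)%N -> g \in long_runs ->
  exists2 l, (1 < l <= r - k)%N & g = run k l.
Proof.
by move=> kr /mapP[l + ->]; rewrite mem_iota => lr; exists l => //; lia.
Qed.

Lemma long_run_split l : (1 < l <= r - k)%N -> exists t,
  [/\ P t, commute (X k) t & run k l = X k * X k.+1 * t].
Proof.
move=> lr; exists (run k.+2 (l - 2)); split.
- by apply: (closed_run clP PX); lia.
- by apply: (run_commute (r := r)) => [|j jl]; [|apply: (rel_comm rel)]; lia.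
have l2 : (2 <= l)%N by lia.
by rewrite -{1}(subnKC l2) run_cat /= addn0 mul1g addn1 addn2.
Qed.

Lemma long_run_notin l : (1 < l <= r - k)%N -> ~ P (run k l).
Proof.
by move=> lr; have := @runs_apart _ _ _ rel P k clP PX nPX 0 l; rewrite !gnorm;
  apply; lia.
Qed.

Lemma long_run_notinV l : (1 < l <= r - k)%N -> ~ P (run k l * (X k)^-1).
Proof.
move=> lr; have := @runs_apart _ _ _ rel P k clP PX nPX 1 l.
by rewrite /= addn0 mul1g; apply; lia.
Qed.

Lemma long_run_notinM l : (1 < l <= r - k)%N -> ~ P (run k l * X k).
Proof.
move=> lr; have [t [Pt ct ->]] := long_run_split lr.
have br : X k * X k.+1 * X k = X k.+1 * X k * X k.+1 by apply: (rel_braid rel);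
  lia.
rewrite -mulgA -ct mulgA br; have PXk : P (X k.+1) by apply: PX; lia.
move=> Pg; apply: nPX.
have [_ PM _] := clP.
apply: (gclosed_cancel (a := X k.+1) (b := X k.+1 * t)) => //;
  first exact: (PM).
by rewrite mulgA.
Qed.

Lemma level_apart : (k < r)%N ->
  ~ P (X k ^+ 2) -> apart P [:: 1, X k, (X k)^-1 & long_runs].
Proof.
move=> kr nP2; have [_ _ PV] := clP.
have nPV : ~ P (X k)^-1 by move=> /PV; rewrite invgK.
split=> [g|]; rewrite ?inE.
  case/or3P=> [/eqP->|/eqP->|/long_runsP[//|l lr ->]]; rewrite !gnorm //.
  exact: long_run_notin.
split=> [g|]; rewrite ?inE.
  case/orP=> [/eqP->|/long_runsP[//|l lr ->]].
    by move=> /PV; rewrite invgM invgK.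
  exact: long_run_notinV.
split=> [g|]; last exact: long_runs_apart.
by case/long_runsP=> // l lr ->; rewrite invgK; apply: long_run_notinM.
Qed.

Lemma level_apart_square : (k < r)%N ->
    ~ P (X k ^+ 2) -> ~ P (X k ^+ 3) ->
  apart P [:: X k ^+ 2, 1, X k, (X k)^-1 & long_runs].
Proof.
move=> kr nP2 nP3; split; last exact: level_apart.
have [_ PM PV] := clP.
have nPV : ~ P (X k)^-1 by move=> /PV; rewrite invgK.
move=> g; rewrite !inE.
case/or4P=> [/eqP->|/eqP->|/eqP->|/long_runsP[//|l lr ->]].
- by rewrite mul1g => /PV; rewrite invgK.
- by rewrite expg2 !gnorm.
- by rewrite -invgM => /PV; rewrite invgK expg2 -[X in P X]mulgA -expg2 -expgS.
have [t [Pt ct ->]] := long_run_split lr.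
have br : X k * X k.+1 * X k = X k.+1 * X k * X k.+1 by apply: (rel_braid rel);
  lia.
have PXk : P (X k.+1) by apply: PX; lia.
have -> : X k * X k.+1 * t * (X k ^+ 2)^-1 =
    (X k * X k.+1 * (X k)^-1) * (X k)^-1 * t.
  have c2 : t * (X k ^+ 2)^-1 = (X k ^+ 2)^-1 * t.
    exact/commuteV/commuteX/commute_sym.
  by rewrite -(mulgA _ t) c2 expg2 !gnorm.
rewrite (braid_swap br).
have -> : (X k.+1)^-1 * X k * X k.+1 * (X k)^-1 * t =
  (X k.+1)^-1 * (X k * X k.+1 * (X k)^-1) * t by rewrite !gnorm.
rewrite (braid_swap br) => Pg; apply: nPX.
apply: (gclosed_cancel (a := (X k.+1)^-1 * (X k.+1)^-1) (b := X k.+1 * t)) =>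
  //.
- by apply: (PM); apply: PV.
- exact: (PM).
by rewrite !gnorm in Pg *.
Qed.

(** If X_k^3 = 1, the coset of X_k^2 is the one of X_k^-1. A replacement is the
    coset of X_k^-1 X_(k+1)^-1, which differs from that of X_k X_(k+1) as long
    as the loop X_k X_(k+1)^2 X_k is not in P. *)
Lemma level_apart_loop : (k.+1 < r)%N ->
    ~ P (X k ^+ 2) -> ~ P (X k * X k.+1 * X k.+1 * X k) ->
  apart P [:: (X k)^-1 * (X k.+1)^-1, 1, X k, (X k)^-1 & long_runs].
Proof.
move=> kr nP2 nPl; split; last by apply: level_apart => //; lia.
have [_ PM PV] := clP.
have br : X k * X k.+1 * X k = X k.+1 * X k * X k.+1 by apply: (rel_braid rel);
  lia.
have PXk : P (X k.+1) by apply: PX; lia.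
have xb : X k * X k.+1 * X k * (X k.+1)^-1 = X k.+1 * X k by rewrite br !gnorm.
move=> g; rewrite !inE.
case/or4P=> [/eqP->|/eqP->|/eqP->|]; rewrite ?invgM ?invgK ?mul1g.
- move=> Pg; apply: nPX.
  by apply: (gclosed_cancel (a := X k.+1) (b := 1)) => //;
    [case: clP|rewrite mulg1].
- have -> : X k * (X k.+1 * X k) = X k.+1 * X k * X k.+1 by rewrite mulgA br.
  by move/(gclosed_cancel clP PXk PXk).
- have -> : (X k)^-1 * (X k.+1 * X k) = X k.+1 * X k * (X k.+1)^-1.
    by rewrite mulgA (braid_swapV br).
  by move/(gclosed_cancel clP PXk (PV _ PXk)).
case/long_runsP=> [|l lr ->]; first by lia.
have [l2|l_neq2] := eqVneq l 2.
  by rewrite l2 /= addn0 mul1g addn1 mulgA.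
have l3 : (3 <= l)%N by lia.
rewrite -(subnKC l3) run_cat /= addn0 mul1g addn1 addn2.
set t := run _ _; have ct0 : commute (X k) t.
  by apply: (run_commute (r := r)) => [|j jl]; [|apply: (rel_comm rel)]; lia.
have ct1 : commute (X k.+1) t.
  by apply: (run_commute (r := r)) => [|j jl]; [|apply: (rel_comm rel)]; lia.
have Pt : P t by apply: (closed_run clP PX); lia.
have PXk2 : P (X k.+2) by apply: PX; lia.
have c02 : commute (X k) (X k.+2) by apply: (rel_comm rel); lia.
have br1 : X k.+1 * X k.+2 * X k.+1 = X k.+2 * X k.+1 * X k.+2.
  by apply: (rel_braid rel); lia.
have -> : X k * X k.+1 * X k.+2 * t * (X k.+1 * X k) =
    X k * (X k.+1 * X k.+2 * X k.+1) * X k * t.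
  by rewrite -!mulgA (mulgA t) -ct1 -(mulgA _ t) -ct0 !mulgA.
have -> : X k * (X k.+1 * X k.+2 * X k.+1) * X k * t =
    (X k.+2 * X k.+1) * X k * (X k.+1 * X k.+2 * t).
  have E : X k * (X k.+2 * X k.+1 * X k.+2) * X k * t =
      X k.+2 * (X k * X k.+1 * X k) * X k.+2 * t.
    by rewrite !mulgA c02 -(mulgA _ (X k.+2) (X k)) -c02 !mulgA.
  by rewrite br1 E br !mulgA.
by move/(gclosed_cancel clP (PM _ _ PXk2 PXk) (PM _ _ (PM _ _ PXk PXk2) Pt)).
Qed.

End Level.
Lemma size_long_runs k : size (long_runs k) = (r - k).-1.
Proof. by rewrite size_map size_iota. Qed.

Lemma long_runs_sub k g : (k < r)%N -> g \in long_runs k -> tail k g.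
Proof.
move=> kr /mapP[l]; rewrite mem_iota => lr ->.
have cl := span_closed (fun g => exists2 j, (k <= j < r)%N & g = X j).
have: (l <= r - k)%N by lia.
elim: l {lr} => [|l IHl] lr /=; first exact: span1.
by apply: spanM; [apply: IHl|apply: tail_gen]; lia.
Qed.

Lemma at_least1 : at_least (tail r) 1.
Proof.
by exists [:: 1] => // g; rewrite inE => /eqP->; apply: span1.
Qed.

Lemma tail_step k N rs : (k < r)%N -> (forall g, g \in rs -> tail k g) ->
  apart (tail k.+1) rs -> at_least (tail k.+1) N ->
  at_least (tail k) (N * size rs).
Proof.
by move=> kr; apply: at_least_cosets => //; try exact: span_closed;
  exact: tail_sub.
Qed.

Lemma tail_mem k : (k < r)%N -> tail k (X k).
Proof. by move=> kr; apply: tail_gen; lia. Qed.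

Lemma tail_next k j : (k < j < r)%N -> tail k.+1 (X j).
Proof. exact: tail_gen. Qed.

Lemma tail_head_notin k i : (0 < k < r)%N -> x ^+ i <> 1 ->
  ~ tail k.+1 (X k ^+ i).
Proof. by move=> kr xi /(expX_notin_tail kr). Qed.

(** The product 4 * 5 * ... * (i + 3) of the numbers of cosets. *)
Lemma tail_card_square i : x ^+ 3 <> 1 -> (i < r)%N ->
  exists2 N, at_least (tail (r - i)) N & (N * 6 = (i + 3)`!)%N.
Proof.
move=> x3; elim: i => [|i IHi] ir.
  by exists 1%N; rewrite // subn0; apply: at_least1.
have [|N HN N6] := IHi; first exact: ltnW.
have [k Ek] : exists k, k = (r - i.+1)%N by exists (r - i.+1)%N.
have k_gt0 : (0 < k < r)%N by lia.
have kr : (k < r)%N by lia.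
have Ei : (r - i = k.+1)%N by lia.
exists (N * (4 + i))%N; last first.
  have -> : ((i.+1 + 3)`! = (i + 3).+1 * (i + 3)`!)%N by rewrite -factS.
  by rewrite mulnAC N6 mulnC; congr (_ * _)%N; lia.
have Es : (4 + i)%N = size [:: X k ^+ 2, 1, X k, (X k)^-1 & long_runs k].
  by rewrite /= size_long_runs; lia.
rewrite -Ek Es; rewrite Ei in HN; apply: tail_step HN => //.
  have Tk := tail_mem kr.
  move=> g; rewrite !inE => /or4P[/eqP->|/eqP->|/eqP->|/orP[/eqP->|]].
  - by rewrite expg2; apply: spanM.
  - exact: span1.
  - by [].
  - exact: spanV.
  exact: long_runs_sub.
apply: level_apart_square => //; first exact: span_closed.
- exact: tail_next.
- by rewrite -[X k]expg1; apply: tail_head_notin => //; rewrite expg1;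
  apply: X0_neq1.
- exact: tail_head_notin.
exact: tail_head_notin.
Qed.

(** The product 3 * 5 * ... * (i + 3): for the last generator alone only the
    powers 1, X, X^-1 are available. *)
Lemma tail_card_cube i : x ^+ 3 = 1 -> (0 < i < r)%N ->
  exists2 N, at_least (tail (r - i)) N & (N * 8 = (i + 3)`!)%N.
Proof.
move=> x3; case: i => // i; elim: i => [|i IHi] ir.
  exists 3; last by [].
  have [k Ek] : exists k, k = (r - 1)%N by exists (r - 1)%N.
  have kr : (k < r)%N by lia.
  have Es : 3 = (1 * size [:: 1%g, X k, (X k)^-1 & long_runs k])%N.
    by rewrite /= size_long_runs; lia.
  rewrite -Ek [X in at_least _ X]Es; apply: tail_step => //.
  - have Tk := tail_mem kr.
    move=> g; rewrite !inE => /or4P[/eqP->|/eqP->|/eqP->|].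
    + exact: span1.
    + by [].
    + exact: spanV.
    exact: long_runs_sub.
  - apply: level_apart => //; first exact: span_closed.
    + exact: tail_next.
    + by rewrite -[X k]expg1; apply: tail_head_notin => //; rewrite ?expg1;
      [lia|exact: X0_neq1].
    by apply: tail_head_notin => //; lia.
  have -> : k.+1 = r by lia.
  exact: at_least1.
have [|N HN N8] := IHi; first by lia.
have [k Ek] : exists k, k = (r - i.+2)%N by exists (r - i.+2)%N.
have k_gt0 : (0 < k < r)%N by lia.
have kr : (k < r)%N by lia.
have Ei : (r - i.+1 = k.+1)%N by lia.
exists (N * (5 + i))%N; last first.
  have -> : ((i.+2 + 3)`! = (i.+1 + 3).+1 * (i.+1 + 3)`!)%N by rewrite -factS.
  by rewrite mulnAC N8 mulnC; congr (_ * _)%N; lia.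
have Es : (5 + i)%N =
    size [:: (X k)^-1 * (X k.+1)^-1, 1, X k, (X k)^-1 & long_runs k].
  by rewrite /= size_long_runs; lia.
rewrite -Ek Es; rewrite Ei in HN; apply: tail_step HN => //.
  have Tk := tail_mem kr.
  have Tk1 : tail k (X k.+1) by apply: tail_gen; lia.
  move=> g; rewrite !inE => /or4P[/eqP->|/eqP->|/eqP->|/orP[/eqP->|]].
  - by apply: spanM; apply: spanV.
  - exact: span1.
  - by [].
  - exact: spanV.
  exact: long_runs_sub.
apply: level_apart_loop => //.
- exact: span_closed.
- exact: tail_next.
- by rewrite -[X k]expg1; apply: tail_head_notin => //; rewrite expg1;
  apply: X0_neq1.
- lia.
- exact: tail_head_notin.
case: k => // k in k_gt0 kr Ei Es Ek *.
move=> /(tail_commute (ltnSn _)) /(X_loop_exp4 rel) x4; apply: X0_neq1.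
have : x ^+ 4 = x by rewrite expgS x3 mulg1.
by move=> <-; apply: x4; lia.
Qed.

End Chain.

(** * The block and its index *)

Section Blocks.
Variables (G : groupType) (r : nat) (v X : nat -> G).
Hypotheses (r_gt1 : (1 < r)%N) (rel : braid'_relations r v X).
Local Notation x := (X 0).
Local Notation run := (run X).
Local Notation tail := (tail r X).
Hypothesis x2 : x ^+ 2 <> 1.

Let x_neq1 : x <> 1 := X0_neq1 x2.

Lemma tail_closed k : gclosed (tail k).
Proof. exact: span_closed. Qed.

(** Each X_j shifts the sequence v by one step, so an element c of the tail
    takes v_(k+p) to v_(k+m). The two offsets avoid negative indices. *)
Lemma tail_shifts c : tail 1 c ->
  exists p m, forall k, c * v (k + p) * c^-1 = v (k + m).
Proof.
elim=> {c} [_ [j jr ->]||c d _ [p [m cE]] _ [p' [m' dE]]|c _ [p [m cE]]].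
- by exists 1%N, 0%N => k; rewrite addn1 addn0 -(vconjV rel).
- by exists 0%N, 0%N => k; rewrite !gnorm.
- exists (p + p')%N, (m + m')%N => k.
  have -> : c * d * v (k + (p + p')) * (c * d)^-1 =
      c * (d * v (k + p + p') * d^-1) * c^-1 by rewrite addnA !gnorm.
  rewrite dE.
  by rewrite (_ : (k + p + m' = k + m' + p)%N) ?cE; [congr v; lia | lia].
by exists m, p => k; rewrite -cE !gnorm.
Qed.

(** Since X_1 is a shift too, c and its conjugate by X_1 shift v by the same
    amount. *)
Lemma tail_shift_commute c : tail 1 c ->
  forall k, commute (((X 1)^-1 * c * X 1)^-1 * c) (v k).
Proof.
move=> /tail_shifts[p [m cE]].
apply: (closed_v_tail (m := p.+1) rel (centraliser_closed _)) => k pk.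
have r1 : (0 < 1 < r)%N by lia.
have E1 : c * v k * c^-1 = v (k - p + m) by rewrite -cE; congr (_ * v _ * _);
  lia.
have : (X 1)^-1 * c * X 1 * v k * ((X 1)^-1 * c * X 1)^-1 = v (k - p + m).
  have -> : k = (k - p.+1 + p).+1 by lia.
  rewrite (vconj rel _ r1).
  have -> : ((k - p.+1 + p).+1 - p + m = (k - p.+1 + m).+1)%N by lia.
  by rewrite (vconj rel _ r1) -cE !gnorm.
rewrite -E1 => E; set d := _ * _ * X 1 in E *.
by rewrite /commute; by_relation d^-1 (esym E).
Qed.

(** Otherwise v_1^-1 v_0, a quotient as in the previous lemma, would commute
    with every v_k, so that v_0 and v_1 would commute. *)
Lemma v0_notin_tail : ~ tail 1 (v 0).
Proof.
move=> /tail_shift_commute/(_ 0%N).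
rewrite -(vconj rel) => [|]; last by lia.
move=> c; apply/x2/(v_commute_exp2 rel).
by rewrite /commute; by_relation (v 1) c.
Qed.

(** Here the quotient is (v_1 v_2)^-1 v_0 v_1, a conjugate of v_0 v_1^-1 v_0. *)
Lemma v01_notin_tail : ~ tail 1 (v 0 * v 1).
Proof.
have r1 : (0 < 1 < r)%N by lia.
move=> /tail_shift_commute c; apply/x2/(v_commute_exp2 rel).
have cV g : commute (v 0 * (v 1)^-1 * v 0) g <->
    commute ((v 1)^-1 * (v 0 * (v 1)^-1 * v 0) * v 1) ((v 1)^-1 * g * v 1).
  split=> E; rewrite /commute; first by by_relation ((v 1)^-1) E.
  by by_relation (v 1) E.
have c0 : commute (v 0 * (v 1)^-1 * v 0) (v 0).
  apply/cV.
  have -> : (v 1)^-1 * (v 0 * (v 1)^-1 * v 0) * v 1 =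
      ((X 1)^-1 * (v 0 * v 1) * X 1)^-1 * (v 0 * v 1).
    have -> : (X 1)^-1 * (v 0 * v 1) * X 1 = v 1 * v 2.
      by rewrite !(vconj rel _ r1) !gnorm.
    by rewrite (vSS rel) !gnorm.
  by apply: commuteM; [apply: commuteM|]; [apply: commuteV| |]; apply: c.
by rewrite /commute; by_relation (v 1 * (v 0)^-1) c0.
Qed.

Lemma tail_unshift g : tail 1 ((X 1)^-1 * g * X 1) -> tail 1 g.
Proof.
have T1 : tail 1 (X 1) by apply: tail_gen; lia.
exact: (gclosed_cancel (tail_closed 1) (spanV T1) T1).
Qed.

Lemma v_notin_tail k : ~ tail 1 (v k).
Proof.
have r1 : (0 < 1 < r)%N by lia.
elim: k => [|k IHk]; first exact: v0_notin_tail.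
by rewrite (vconj rel k r1) => /tail_unshift/IHk.
Qed.

Lemma vv_notin_tail k : ~ tail 1 (v k * v k.+1).
Proof.
have r1 : (0 < 1 < r)%N by lia.
elim: k => [|k IHk]; first exact: v01_notin_tail.
rewrite (vconj rel k r1) (vconj rel k.+1 r1).
have -> : (X 1)^-1 * v k * X 1 * ((X 1)^-1 * v k.+1 * X 1) =
  (X 1)^-1 * (v k * v k.+1) * X 1 by rewrite !gnorm.
by move=> /tail_unshift/IHk.
Qed.

Definition block :=
  span (fun g => g = v 0 \/ exists2 j, (0 < j < r)%N & g = X j).

Lemma block_closed : gclosed block. Proof. exact: span_closed. Qed.

Lemma block_X j : (0 < j < r)%N -> block (X j).
Proof. by move=> jr; apply: span_gen; right; exists j. Qed.

Lemma block_v k : block (v k).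
Proof.
apply: (closed_v r_gt1 rel block_closed); first by apply: span_gen; left.
by apply: block_X; lia.
Qed.

Lemma block_tail g : tail 1 g -> block g.
Proof. by move: g; apply: span_min block_closed _ => _ [j jr ->];
  apply: block_X. Qed.

(** The relations turn the quotient of any two of the representatives 1, v_1,
    v_2, v_3^-1 into some v_k or v_k v_(k+1), or an inverse of these. *)
Lemma block_card N : at_least (tail 1) N -> at_least block (N * 4).
Proof.
have -> : 4 = size [:: 1%g; v 1; v 2; (v 3)^-1] by [].
apply: (at_least_cosets (tail_closed 1) block_closed block_tail).
  move=> g; rewrite !inE => /or4P[] /eqP->; try exact: block_v.
    exact: span1.
  exact/spanV/block_v.
have nV g : ~ tail 1 g -> ~ tail 1 g^-1 by move=> ng /spanV; rewrite invgK.
split=> [g|]; rewrite ?inE.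
  case/or3P=> /eqP->; rewrite !gnorm; try exact: v_notin_tail.
  exact/nV/v_notin_tail.
split=> [g|]; rewrite ?inE.
  case/orP=> /eqP->.
    have -> : v 2 * (v 1)^-1 = (v 0)^-1 by rewrite (vV rel 0) !gnorm.
    exact/nV/v_notin_tail.
  by rewrite -invgM -(rel_vv rel); apply/nV/v_notin_tail.
split=> [g|]; rewrite ?inE //.
by move=> /eqP->; rewrite -invgM; apply/nV/vv_notin_tail.
Qed.

Section Index.
Hypothesis nx : ~ block x.

Let cancel a b g : block a -> block b -> block (a * g * b) -> block g.
Proof. exact: gclosed_cancel block_closed. Qed.

Lemma block_conj_v k : ~ block (x * v k.+2 * x^-1).
Proof.
by rewrite (X0conj rel) => /(cancel (spanV (block_v k)) (block_v k.+1)).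
Qed.

Lemma block_sandwich k : ~ block (x * v k.+1 * x).
Proof.
by rewrite -(rel_vX0 rel) => /(cancel (block_v k) (block_v k.+2)).
Qed.

Definition short_runs := [seq run 0 l | l <- iota 0 r.+1].

Lemma short_runsP g : g \in short_runs -> exists2 l, (l <= r)%N & g = run 0 l.
Proof. by case/mapP=> l; rewrite mem_iota => lr ->; exists l. Qed.

Lemma short_runs_apart : apart block short_runs.
Proof.
apply: apart_iota => i j ij jm.
by apply: (runs_apart rel block_closed block_X nx); lia.
Qed.

Lemma block_run_X0 l : (1 < l <= r)%N -> run 0 l * x = X 1 * run 0 l.
Proof. by case: l => // l lr; apply: (run_shift rel); lia. Qed.

Lemma run_notin_block l : (0 < l <= r)%N -> ~ block (run 0 l).
Proof.
move=> lr; have := @runs_apart _ _ _ rel _ 0 block_closed block_X nx 0 l.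
by rewrite /= invg1 mulg1; apply; lia.
Qed.

(** Let R be a run of length at least 2. Then R x = X_1 R, and X_1 is in the
    block. So if R (x v_m)^-1 is in the block, where m = k + 3, then so is R x
    (x v_m)^-1. The quotient of these two elements is x v_m x v_m^-1 x^-1, which
    equals v_(m-1) (x v_(m-1) x^-1)^-1. *)
Lemma run_v_apart l k : (l <= r)%N -> ~ block (run 0 l * (x * v k.+3)^-1).
Proof.
have nV g : ~ block g -> ~ block g^-1 by move=> ng /spanV; rewrite invgK.
case: l => [|[|l]] lr.
- rewrite /= mul1g; apply: nV => Pg; apply: nx.
  by apply: (cancel (span1 _) (block_v k.+3)); rewrite mul1g.
- rewrite /= mul1g addn0 invgM mulgA => Pg.
  by apply: (@block_conj_v k.+1); move: Pg => /spanV; rewrite !gnorm.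
set R := run 0 l.+2 => PR.
have B1 : block (X 1) by apply: block_X; lia.
have PR2 : block (R * x * (x * v k.+3)^-1).
  by rewrite /R block_run_X0 // -mulgA; apply: spanM.
have : block ((R * (x * v k.+3)^-1)^-1 * (R * x * (x * v k.+3)^-1)).
  by apply: spanM => //; apply: spanV.
have -> : (R * (x * v k.+3)^-1)^-1 * (R * x * (x * v k.+3)^-1) =
  (x * v k.+3 * x) * (v k.+3)^-1 * x^-1 by rewrite !gnorm.
rewrite -(rel_vX0 rel).
have -> : v k.+2 * x * v k.+4 * (v k.+3)^-1 * x^-1 =
   v k.+2 * (x * v k.+2 * x^-1)^-1 * 1.
  by rewrite (vSS rel k.+2) !gnorm.
by move/(cancel (block_v _) (span1 _))/spanV; rewrite invgK;
  apply: block_conj_v.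
Qed.

Lemma vv_apart k : ~ block (x * v k.+3 * (x * v k.+4)^-1).
Proof.
have -> : x * v k.+3 * (x * v k.+4)^-1 = x * v k.+2 * x^-1.
  by rewrite (vV rel k.+2) !gnorm.
exact: block_conj_v.
Qed.

Lemma index_apart : apart block [:: x * v 4, x * v 3 & short_runs].
Proof.
split=> [g|].
  rewrite inE => /predU1P[->|]; first exact: (@vv_apart 0).
  by case/short_runsP=> l lr ->; apply: run_v_apart.
split; last exact: short_runs_apart.
by move=> g /short_runsP[l lr ->]; apply: run_v_apart.
Qed.

Lemma index_apart_cube : x ^+ 3 = 1 ->
  apart block [:: x * v 4, x * v 3, x^-1 & short_runs].
Proof.
have nV g : ~ block g -> ~ block g^-1 by move=> ng /spanV; rewrite invgK.
move=> x3; split=> [g|].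
  rewrite !inE => /or3P[/eqP->|/eqP->|].
  - exact: (@vv_apart 0).
  - by rewrite -invgM; apply/nV/block_sandwich.
  by case/short_runsP=> l lr ->; apply: run_v_apart.
split=> [g|].
  rewrite !inE => /predU1P[->|].
    by rewrite -invgM; apply/nV/block_sandwich.
  by case/short_runsP=> l lr ->; apply: run_v_apart.
split; last exact: short_runs_apart.
move=> g /short_runsP[l lr ->]; rewrite invgK.
case: l => [|[|l]] in lr *; first by rewrite mul1g.
  rewrite /= mul1g addn0.
  have -> : x * x = x^-1 by apply: (mulgI x); rewrite mulgV -x3 !expgS mulg1.
  exact: nV.
rewrite block_run_X0 // => BX; apply: (@run_notin_block l.+2) => //.
have B1 : block (X 1) by apply: block_X; lia.
by apply: (cancel B1 (span1 _)); rewrite mulg1.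
Qed.

Lemma total_closed : gclosed (fun _ : G => True). Proof. by []. Qed.

(** Here r + 3 is the number of strands. With x^3 = 1 the count is (r+2)!/8 * 4
    * (r+4), otherwise it is (r+2)!/6 * 4 * (r+3). *)
Lemma card_not_block : exists2 N, ((r + 3)`! < 2 * N)%N & at_least (fun _ : G =>
  True) N.
Proof.
have Er : (r - r.-1 = 1)%N by lia.
have r3 : ((r.-1 + 3)`! = (r + 2)`!)%N by congr _`!; lia.
have r4 : ((r + 3)`! = (r + 3) * (r + 2)`!)%N by rewrite !addnS factS addn0.
have f0 := fact_gt0 (r + 2).
have [x3|x3] := eqVneq (x ^+ 3) 1.
  have [|N] := @tail_card_cube _ _ _ _ r_gt1 rel x2 r.-1 x3; first by lia.
  rewrite Er r3 => /block_card HN N8.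
  exists (N * 4 * (r + 4))%N; first by rewrite r4; nia.
  have -> : (r + 4)%N = size [:: x * v 4, x * v 3, x^-1 & short_runs].
    by rewrite /= size_map size_iota; lia.
  by apply: (at_least_cosets block_closed total_closed) HN => //;
    apply: index_apart_cube.
have [||N] := @tail_card_square _ _ _ _ r_gt1 rel x2 r.-1; first exact/eqP.
  by lia.
rewrite Er r3 => /block_card HN N6.
exists (N * 4 * (r + 3))%N; first by rewrite r4; nia.
have -> : (r + 3)%N = size [:: x * v 4, x * v 3 & short_runs].
  by rewrite /= size_map size_iota; lia.
by apply: (at_least_cosets block_closed total_closed) HN => //;
  apply: index_apart.
Qed.

End Index.

(** The normal closure of v_0 in the block. *)
Definition core := span (fun g => exists k, g = v k).

Lemma core_v k : core (v k). Proof. by apply: span_gen; exists k. Qed.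

Lemma block_normalises_core g : block g ->
  forall h, core h -> core (g * h * g^-1) /\ core (g^-1 * h * g).
Proof.
have core_conj g1 : (forall k, core (g1 * v k * g1^-1)) ->
    forall h, core h -> core (g1 * h * g1^-1).
  move=> gv h; elim=> {h} [_ [k ->] //||h h' _ Hh _ Hh'|h _ Hh].
  - by rewrite mulg1 mulgV; apply: span1.
  - have -> : g1 * (h * h') * g1^-1 = (g1 * h * g1^-1) * (g1 * h' * g1^-1).
      by rewrite !gnorm.
    exact: spanM.
  have -> : g1 * h^-1 * g1^-1 = (g1 * h * g1^-1)^-1 by rewrite !gnorm.
  exact: spanV.
elim=> {g} [g Sg|h|g g' _ Hg _ Hg' h Ch|g _ Hg h /Hg[]].
- have {Sg}[gv gv'] : (forall k, core (g * v k * g^-1)) /\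
  (forall k, core (g^-1 * v k * g)).
    case: Sg => [->|[j jr ->]]; split=> k.
    + by apply: spanM; [apply: spanM|apply: spanV]; apply: core_v.
    + by apply: spanM; [apply: spanM; [apply: spanV|]|]; apply: core_v.
    + case: k => [|k]; last by rewrite -(vconjV rel); first exact: core_v.
      have -> : X j * v 0 * (X j)^-1 = v 0 * (v 1)^-1.
        by rewrite {1}(vV rel 0) [in RHS](vconjV rel 1 jr) [in RHS](vconjV rel 0
            jr) !gnorm.
      by apply: spanM; [|apply: spanV]; apply: core_v.
    by rewrite -(vconj rel); first exact: core_v.
  move=> h Ch; split; first exact: core_conj.
  by rewrite -{2}[g]invgK; apply: core_conj => // k; rewrite invgK.
- by rewrite !gnorm.
- have [C1 _] := Hg' _ Ch; have [_ C2] := Hg _ Ch.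
  have [{}C1 _] := Hg _ C1; have [_ {}C2] := Hg' _ C2.
  by rewrite !gnorm in C1 C2 *.
by rewrite invgK.
Qed.

(** The block normalises the core. So if it contains x, then x^-1 v_0 x = v_1 x
    v_2^-1 is in the core. *)
Lemma block_core : block x -> core x.
Proof.
move=> /block_normalises_core/(_ (v 0) (core_v 0))[_].
rewrite (X0conjV rel).
exact: (gclosed_cancel (span_closed _) (core_v 1) (spanV (core_v 2))).
Qed.

(** The elements X_1 and X_2 act in the same way on the core. If x were in it,
    then X_1 X_2^-1 would commute with x, and so would X_1, since X_2 does. *)
Lemma block_proper : (2 < r)%N -> ~ block x.
Proof.
move=> r_gt2 /block_core Cx.
have c : commute (X 1 * (X 2)^-1) x.
  move: x Cx; apply: span_min (centraliser_closed _) _ => _ [k ->].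
  apply: commute_sym; rewrite /commute.
  have E1 : v k * X 1 = X 1 * v k.+1 by apply: (rel_vX rel); lia.
  have E2 : v k * X 2 = X 2 * v k.+1 by apply: (rel_vX rel); lia.
  have {}E2 : v k.+1 * (X 2)^-1 = (X 2)^-1 * v k
    by by_relation ((X 2)^-1) (esym E2).
  by rewrite mulgA E1 -!mulgA E2.
apply: x_neq1; have := @commuteX_trivial _ _ _ _ rel 0 1; rewrite !expg1; apply;
  first by lia.
have -> : X 1 = X 1 * (X 2)^-1 * X 2 by rewrite !gnorm.
by apply: commuteM; [apply: commute_sym|apply: (rel_comm rel)].
Qed.

End Blocks.

(** * Equality modulo the centre *)

Section Centre.
Variable G : groupType.
Implicit Types c g h k : G.

Definition central c := forall g, commute c g.

Lemma central1 : central 1.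
Proof. by move=> g; apply/commute_sym/commute1. Qed.

Lemma centralM c d : central c -> central d -> central (c * d).
Proof. by move=> cc cd g; apply/commute_sym/commuteM; apply/commute_sym. Qed.

Lemma centralV c : central c -> central c^-1.
Proof. by move=> cc g; apply/commute_sym/commuteV/commute_sym. Qed.

Definition same_mod_centre g h := exists2 c, central c & g = c * h.
Local Notation "g ~~ h" := (same_mod_centre g h) (at level 70).

Lemma same_refl g : g ~~ g.
Proof. by exists 1; [exact: central1 | rewrite mul1g]. Qed.

Lemma same_sym g h : g ~~ h -> h ~~ g.
Proof. by case=> c cc ->; exists c^-1; [exact: centralV | rewrite mulKg]. Qed.

Lemma same_trans h g k : g ~~ h -> h ~~ k -> g ~~ k.
Proof.
move=> [c cc ->] [d cd ->]; exists (c * d); first exact: centralM.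
by rewrite mulgA.
Qed.

Lemma same_conj k g h : g ~~ h -> k * g * k^-1 ~~ k * h * k^-1.
Proof.
move=> [c cc ->]; exists c => //.
by rewrite !mulgA -(cc k).
Qed.

Lemma same_conjV k g h : k * g * k^-1 ~~ k * h * k^-1 -> g ~~ h.
Proof. by move/(same_conj k^-1); rewrite !gnorm. Qed.
End Centre.
Notation "g ~~ h" := (same_mod_centre g h) (at level 70).

(** * Five strands, when the block is the whole group *)

(** With r = 2 the group is generated by v_0 and a = X_1, and conjugation by a
    shifts the sequence v. So does conjugation by w = v_0 v_3, but by six steps;
    this makes w a^-6 central. *)
Section FiveStrands.
Variables (G : groupType) (v X : nat -> G).
Hypothesis rel : braid'_relations 2 v X.
Local Notation x := (X 0).
Local Notation a := (X 1).
Hypothesis x2 : x ^+ 2 <> 1.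
Hypothesis full : forall P, gclosed P -> P (v 0) -> P a -> forall g : G, P g.

Let r_gt1 : (1 < 2)%N := isT.
Let x_neq1 : x <> 1 := X0_neq1 x2.

Let xa : x * a * x = a * x * a.
Proof. exact: (rel_braid rel). Qed.

Let a_conj : a = (x * a) * x * (x * a)^-1.
Proof. by rewrite braid_conj. Qed.

Lemma expa_eq1 k : x ^+ k = 1 -> a ^+ k = 1.
Proof.
move=> xk; rewrite a_conj.
have -> : (x * a) * x * (x * a)^-1 = x ^ (x * a)^-1 by rewrite conjgE !gnorm.
by rewrite -conjXg xk conj1g.
Qed.

Lemma v_shift k : v k * a = a * v k.+1.
Proof. exact: (rel_vX rel). Qed.

Local Notation w := (v 0 * v 3).

Lemma vv3_const k : v k * v k.+3 = w.
Proof.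
elim: k => // k <-.
by rewrite (vSS rel k.+2) [in LHS](rel_vv rel k) !gnorm.
Qed.

Lemma v_shiftX i k : a ^+ i * v (k + i) = v k * a ^+ i.
Proof.
elim: i => [|i IHi]; first by rewrite addn0 !gnorm.
by rewrite expgSr addnS -mulgA -v_shift !mulgA IHi.
Qed.

(** Locked so that normalising a word does not unfold it. *)
Definition centre_gen := locked (w * (a ^+ 6)^-1).

Lemma centre_genE : w = centre_gen * a ^+ 6.
Proof. by rewrite /centre_gen -lock mulgVK. Qed.

Lemma centre_gen_central : central centre_gen.
Proof.
have wa : commute w a.
  by rewrite /commute -mulgA v_shift mulgA v_shift -mulgA vv3_const.
have wv : v 0 * w = w * v 6 by rewrite -{1}(vv3_const 3) mulgA.
apply: full; first exact: centraliser_closed.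
  rewrite /centre_gen -lock; apply: commute_sym.
  have E := v_shiftX 6 0; rewrite add0n in E; rewrite /commute mulgA wv -mulgA.
  by by_relation (w * (a ^+ 6)^-1) E.
rewrite /centre_gen -lock; apply/commute_sym/commuteM; first exact/commute_sym.
exact/commuteV/commuteX.
Qed.

(** Otherwise a^6 = 1 as well, so that w is central; now use [w_commute_exp4].
    *)
Lemma exp6_neq1 : x ^+ 6 <> 1.
Proof.
move=> x6; have x4 : x ^+ 4 = 1.
  apply: (w_commute_exp4 rel).
  rewrite centre_genE (expa_eq1 x6) mulg1.
  exact/commute_sym/centre_gen_central.
by apply: x2; rewrite -x6 (expgD x 4 2) x4 mul1g.
Qed.

(** Otherwise w = c a with c central. The type B relation between x and w
    becomes x a x a = a x a x, and the braid relation reduces this to x = a. *)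
Lemma exp5_neq1 : x ^+ 5 <> 1.
Proof.
move=> x5; have a6 : a ^+ 6 = a by rewrite expgS (expa_eq1 x5) mulg1.
have := loops_commute rel; rewrite centre_genE a6 => E.
have cz := centre_gen_central; move: centre_gen cz E => c cz.
have xc : x * c = c * x by rewrite cz.
have ac : a * c = c * a by rewrite cz.
have -> : x * (c * a) * x * (c * a) = c * c * (x * a * x * a).
  by rewrite !mulgA xc -(mulgA _ x c) xc !mulgA -(mulgA _ a c) ac !mulgA
             -(mulgA c x c) xc !mulgA.
have -> : c * a * x * (c * a) * x = c * c * (a * x * a * x).
  by rewrite !mulgA -(mulgA _ x c) xc !mulgA -(mulgA c a c) ac !mulgA.
move/mulgI; rewrite xa -!mulgA => /mulgI/mulgI/mulgI E.
by apply: x_neq1; apply: (@exp_eq_trivial _ _ _ _ rel 1 1) => //;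
  rewrite !expg1.
Qed.

(** The case x^4 = 1. The elements a^-1 and b = v_0 a^-1 satisfy the braid
    relation, and their squares commute modulo the centre. Therefore, modulo the
    centre, v_0 = b a permutes a^2 and its two further conjugates cyclically,
    whereas a exchanges two of the three. The subgroup generated by the v_k acts
    on the three by rotations. But it is the whole group, so the action of a has
    to be trivial: the three conjugates agree modulo the centre, and this forces
    a^2 to be central. *)
Section Parity.
Hypothesis x4 : x ^+ 4 = 1.

Lemma core_full g : core v g.
Proof.
have Bx h : block 2 v X h.
  apply: full; first exact: span_closed; first exact: block_v.
  exact: block_X.
have Cx : core v x by apply: (block_core rel).
apply: full; first exact: span_closed; first exact: core_v.
rewrite a_conj.
by have [] := block_normalises_core rel (Bx (x * a)) Cx.
Qed.

Local Notation b := (v 0 * a^-1).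

Let a4 : a ^+ 4 = 1 := expa_eq1 x4.

Let a2V : a * a = a^-1 * a^-1.
Proof. by apply: (mulgI (a * a)); rewrite !gnorm -a4 !expgS !gnorm. Qed.

Let ab : a^-1 * b * a^-1 = b * a^-1 * b.
Proof.
have E : v 1 = v 0 * v 2 := rel_vv rel 0.
have E1 : v 1 = a^-1 * v 0 * a by rewrite -mulgA v_shift !gnorm.
have E2 : v 2 = a^-1 * v 1 * a by rewrite -mulgA v_shift !gnorm.
rewrite E2 E1 in E.
have {}E : a^-1 * v 0 * a^-1 = v 0 * (a^-1 * a^-1) * v 0.
  by by_relation (1 : G) E.
by by rewrite !gnorm in E *; rewrite E.
Qed.

Local Notation c := centre_gen.

(** This is v_0 a^-3 v_0 = w a^-3 = c a^3 rewritten with a^4 = 1. *)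
Let b_a2_b : b * (a * a) * b = c * (a * a).
Proof.
have a3 : v 3 = (a * a * a)^-1 * v 0 * (a * a * a).
  have E : a ^+ 3 * v 3 = v 0 * a ^+ 3 := v_shiftX 3 0.
  by rewrite !expgS !gnorm in E; by_relation ((a * a * a)^-1) E.
have a1 : a = (a * a * a)^-1 by apply: (mulIg (a * a * a));
  rewrite mulVg -a4 !expgS !gnorm.
have -> : b * (a * a) * b = v 0 * a * v 0 * a^-1 by rewrite !gnorm.
rewrite [X in v 0 * X * v 0]a1.
have -> : v 0 * (a * a * a)^-1 * v 0 = w * (a * a * a)^-1 by rewrite a3 !gnorm.
have a6 : a ^+ 6 = a * a by rewrite (expgD a 4 2) a4 mul1g expg2.
by rewrite centre_genE a6 [in RHS]a2V !gnorm.
Qed.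

Let b4 : b * b = (b * b)^-1.
Proof.
have -> : b = (a^-1 * b) * a^-1 * (a^-1 * b)^-1 by rewrite (braid_conj ab).
move: (a^-1 * b) => k.
have -> : k * a^-1 * k^-1 * (k * a^-1 * k^-1) = k * (a^-1 * a^-1) * k^-1.
  by rewrite !gnorm.
by rewrite -{1}a2V !gnorm.
Qed.

Let b2_a2 : b * b * (a * a) * (b * b)^-1 = c * c * (a * a).
Proof.
rewrite -b4; have -> : b * b * (a * a) * (b * b) = b * (b * (a * a) * b) * b.
  by rewrite !mulgA.
have bc : b * c = c * b by rewrite centre_gen_central.
by rewrite b_a2_b (mulgA b c) bc -2!(mulgA c) b_a2_b mulgA.
Qed.

Let a2_b2 : same_mod_centre (a * a * (b * b) * (a * a)^-1) (b * b).
Proof.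
exists ((c * c)^-1).
  by apply/centralV/centralM; apply: centre_gen_central.
by_relation ((c * c)^-1) (esym b2_a2).
Qed.

Let b_conj_a2 : b * (a * a) * b^-1 = a * (b * b) * a^-1.
Proof.
have y := braid_swap (esym ab); rewrite invgK in y.
have -> : b * (a * a) * b^-1 = (b * a^-1 * b^-1)^-1 * (b * a^-1 * b^-1)^-1.
  by rewrite !gnorm.
by rewrite y [in RHS]b4 !gnorm.
Qed.

(** The three conjugates, repeated with period 3 modulo the centre. *)
Definition turn i := iter i (fun g => v 0 * g * (v 0)^-1) (a * a).

Lemma turnD i j : turn i ~~ turn j -> forall k, turn (k + i) ~~ turn (k + j).
Proof. by move=> Eij; elim=> // k IHk; rewrite !addSn /=; apply: same_conj. Qed.

Let turn1 : turn 1 = a * (b * b) * a^-1.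
Proof. by rewrite -b_conj_a2 /= !gnorm. Qed.

Let turn2 : turn 2 ~~ b * b.
Proof.
have -> : turn 2 = v 0 * turn 1 * (v 0)^-1 by [].
rewrite turn1.
have -> : v 0 * (a * (b * b) * a^-1) * (v 0)^-1 =
   b * (a * a * (b * b) * (a * a)^-1) * b^-1 by rewrite !gnorm.
have {2}-> : b * b = b * (b * b) * b^-1 by rewrite !gnorm.
exact: same_conj.
Qed.

Let turn3 i : turn (i + 3) ~~ turn i.
Proof.
rewrite -[X in _ ~~ turn X]addn0; apply: turnD.
have := same_conj (v 0) turn2; rewrite -/(turn 3) => /same_trans; apply.
have -> : v 0 * (b * b) * (v 0)^-1 = b * (b * (a * a) * b^-1) * b^-1.
  by rewrite b_conj_a2 !gnorm.
exists (c * c); first by apply: centralM; apply: centre_gen_central.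
by rewrite -b2_a2 !gnorm.
Qed.

Let turn_mod i m : turn (i + m * 3) ~~ turn i.
Proof.
elim: m => [|m IHm]; first by rewrite addn0; apply: same_refl.
by rewrite mulSn addnA addnAC; apply: same_trans (turn3 _) IHm.
Qed.

(** The exchange of turn 1 and turn 2 is multiplication by 2 modulo 3. *)
Let a_turn i : a * turn i * a^-1 ~~ turn (2 * i).
Proof.
have [n] := ubnP i; elim: n i => // n IHn [|[|[|i]]] lt_in.
- by rewrite /= !gnorm; apply: same_refl.
- apply: same_trans (same_sym turn2); rewrite turn1.
  by move: a2_b2; rewrite !gnorm.
- apply: same_trans (same_conj a turn2) _; rewrite -turn1.
  exact/same_sym/(turn3 1).
have -> : (2 * i.+3 = 2 * i + 3 + 3)%N by lia.
apply: same_trans (same_sym (turn3 _)); apply: same_trans (same_sym (turn3 _)).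
rewrite -(addn3 i); apply: same_trans (same_conj a (turn3 i)) _.
by apply: IHn; lia.
Qed.

Definition rotation g := exists p, forall i, g * turn i * g^-1 ~~ turn (i + p).

Lemma rotation_closed : gclosed rotation.
Proof.
split=> [|g h [p gp] [k hk]|g [p gp]].
- by exists 0%N => i; rewrite addn0 !gnorm; apply: same_refl.
- exists (k + p)%N => i; rewrite addnA.
  have -> : g * h * turn i * (g * h)^-1 = g * (h * turn i * h^-1) * g^-1.
    by rewrite !gnorm.
  exact: same_trans (same_conj g (hk i)) (gp _).
exists (2 * p)%N => i; apply: (same_conjV (k := g)).
have -> : g * (g^-1 * turn i * (g^-1)^-1) * g^-1 = turn i by rewrite !gnorm.
apply: same_trans (same_sym (gp _)).
have -> : (i + 2 * p + p = i + p * 3)%N by lia.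
exact/same_sym/turn_mod.
Qed.

(** The doubling i -> 2i is its own inverse modulo 3, and conjugation by it
    takes the rotation by p to the rotation by 2p. *)
Lemma rotation_conj_a g : rotation g -> rotation (a * g * a^-1).
Proof.
move=> [p gp]; exists (2 * p)%N => i.
have turn_a : turn i ~~ a * turn (2 * i) * a^-1.
  apply: same_sym; apply: same_trans (a_turn _) _.
  have -> : (2 * (2 * i) = i + i * 3)%N by lia.
  exact: turn_mod.
apply: same_trans (same_conj _ turn_a) _.
have -> : a * g * a^-1 * (a * turn (2 * i) * a^-1) * (a * g * a^-1)^-1 =
   a * (g * turn (2 * i) * g^-1) * a^-1 by rewrite !gnorm.
apply: same_trans (same_conj a (gp _)) _; apply: same_trans (a_turn _) _.
have -> : (2 * (2 * i + p) = i + 2 * p + i * 3)%N by lia.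
exact: turn_mod.
Qed.

Lemma exp4_neq1 : False.
Proof.
have v_rotation k : rotation (v k).
  elim: k => [|k [p kp]].
    by exists 1%N => i; rewrite addn1; apply: same_refl.
  have -> : v k.+1 = a * (a * (a * v k * a^-1) * a^-1) * a^-1.
    (* conjugation by a^-1 shifts v, and a^-1 = a^3 *)
    have a1 : a^-1 = a * a * a.
      by apply: (mulIg a); rewrite mulVg -a4 !expgS !gnorm.
    have E : v k * a = a * v k.+1 := v_shift k.
    have -> : a * (a * (a * v k * a^-1) * a^-1) * a^-1 =
      a * a * a * v k * (a * a * a)^-1 by rewrite !gnorm.
    by rewrite -a1 invgK -mulgA E mulKg.
  by do 3 apply: rotation_conj_a; exists p.
have [p ap] : rotation a.
  move: a (core_full a); apply: span_min; first exact: rotation_closed.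
  by move=> _ [k ->].
have p0 : turn 0 ~~ turn p by have := ap 0%N; rewrite add0n /= !gnorm.
(* a acts as a rotation and as the doubling; compare both on turn 1 *)
have t12 : turn 1 ~~ turn 2.
  apply: same_trans (turnD p0 1) _.
  exact: same_trans (same_sym (ap 1%N)) (a_turn _).
have {t12} [d cd E] : turn 0 ~~ turn 1 by apply: (same_conjV (k := v 0)).
have aab : commute (a * a) b.
  have b2 : b * b = d^-1 * (a * a).
    rewrite turn1 /= in E.
    have -> : b * b = a^-1 * (a * (b * b) * a^-1) * a by rewrite !gnorm.
    have -> : a * (b * b) * a^-1 = d^-1 * (a * a) by rewrite E mulKg.
    by rewrite mulgA -(centralV cd) !gnorm.
  have : commute (b ^+ 2) a^-1.
    rewrite expg2 b2; apply/commuteV/commute_sym/commuteM.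
      exact/commute_sym/centralV.
    exact/commuteM/commute_refl/commute_refl.
  move/(braid_commuteX (esym ab)); rewrite !expg2 -a2V => <-.
  exact/commute_sym/commuteM/commute_refl/commute_refl.
apply: x2; apply: (commuteX_trivial' rel (k := 0)) => //.
rewrite expg2; apply: commute_sym.
move: x; apply: full; first exact: centraliser_closed.
  rewrite (_ : v 0 = b * a); last by rewrite mulgVK.
  apply: commuteM aab _; exact/commute_sym/commuteM/commute_refl/commute_refl.
exact/commute_sym/commuteM/commute_refl/commute_refl.
Qed.

End Parity.

Lemma expx_neq1 i : (0 < i < 7)%N -> x ^+ i <> 1.
Proof.
case: i => [|[|[|[|[|[|[|i]]]]]]] // _.
- by move=> x3; apply: exp6_neq1; rewrite (expgD x 3 3) x3 mulg1.
- exact: exp4_neq1.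
- exact: exp5_neq1.
- exact: exp6_neq1.
Qed.

(** Conjugating x by the inverses of these elements gives x, x^-1 and the seven
    elements x^(i-1) a x^(1-i). *)
Definition x_conjugators :=
  [:: 1, v 0 * x * v 3 & [seq a^-1 * x ^- i | i <- iota 0 7]].

Lemma x_conjugators_apart : apart (commute x) x_conjugators.
Proof.
have ax : a * x * a^-1 = x^-1 * a * x.
  by rewrite -(braid_swapV xa).
have commute_a i : commute x (a^-1 * x ^- i) -> False.
  move=> c; apply: x_neq1.
  have ca : commute x a.
    rewrite -[a]invgK; apply: commuteV; rewrite -[a^-1](mulgVK (x ^+ i)).
    by apply: commuteM c _; apply: commuteX.
  by apply: (commuteX_trivial rel (k := 0) (i := 1)).
have tx : v 0 * x * v 3 * x = x^-1 * (v 0 * x * v 3).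
  by have := swap_inverts rel => <-; rewrite mulgVK.
split=> [g|].
  rewrite inE invg1 mulg1 => /predU1P[-> c|/mapP[i _ ->]].
    by apply: x2; rewrite expg2 -(mulVg x); congr (_ * _);
      apply: (mulIg (v 0 * x * v 3)); rewrite -tx.
  exact: commute_a.
split=> [g /mapP[i _ ->] c|].
  move: (v 0 * x * v 3) tx c => t tx c.
  have xt : x * t = t * x^-1 by by_relation (x : G) tx.
  apply: (commute_a 0%N); rewrite expg0 invg1 mulg1; apply: commuteV.
  suff -> : a = x^-1 by apply/commuteV/commute_refl.
  apply: (mulIg x); apply: (mulgI x^-1); rewrite mulVg mulg1 mulgA -ax.
  have E : x * a^-1 = a^-1 * x^-1.
    apply: (mulIg (x ^- i * t^-1)); move: c; rewrite /commute !mulgA => ->.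
    have tV : t^-1 * x = x^-1 * t^-1 by by_relation (t^-1) xt.
    have xi : commute x^-1 (x ^- i) by
      exact/commuteV/commuteX/commute_sym/commuteV/commute_refl.
    by rewrite -(mulgA _ t^-1) tV -(mulgA a^-1 x^-1) xi !mulgA.
  by rewrite -mulgA E mulKVg.
apply: apart_iota => i j /= ij j7 c.
apply: (@expx_neq1 (j - i)); first by lia.
apply: (commuteX_trivial rel (k := 0)) => //.
apply: (gclosed_cancel (centraliser_closed _) (a := x^-1) (b := x)).
- exact/commuteV/commute_sym/commuteX/commute_refl.
- exact/commute_sym/commuteX/commute_refl.
rewrite -ax.
have {}c : x * (a^-1 * x ^+ (j - i) * a) = a^-1 * x ^+ (j - i) * a * x.
  suff -> : a^-1 * x ^+ (j - i) * a = (a^-1 * x ^- j * (a^-1 * x ^- i)^-1)^-1.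
    exact: commuteV.
  have Ej : x ^+ j = x ^+ i * x ^+ (j - i) by rewrite -expgD subnKC // ltnW.
  by rewrite Ej; move: (x ^+ i) (x ^+ (j - i)) => y y'; rewrite !gnorm.
by rewrite /commute; move: (x ^+ _) c => y c; by_relation (a : G) (esym c).
Qed.

Lemma card_five_strands : at_least (fun _ : G => True) 63.
Proof.
have c : at_least (commute x) 7.
  exists [seq x ^+ i | i <- iota 0 7]; last by move=> _ /mapP[i _ ->];
    apply: commuteX.
  split; last by rewrite size_map size_iota.
  rewrite map_inj_in_uniq ?iota_uniq // => i j; rewrite !mem_iota => i7 j7 E.
  wlog ij : i j i7 j7 E / (i < j)%N.
    by move=> W; case: (ltngtP i j) => // [/W|/(W _ _ j7 i7 (esym E))]->.
  case: (@expx_neq1 (j - i)); first by lia.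
  by apply: (mulgI (x ^+ i)); rewrite mulg1 -expgD E subnKC // ltnW.
have := at_least_cosets (centraliser_closed x) (@total_closed G) _ _
  x_conjugators_apart c.
by apply.
Qed.
End FiveStrands.

Theorem large_quotient (G : groupType) (r : nat) (v X : nat -> G) :
    (1 < r)%N -> braid'_relations r v X ->
    (forall P : G -> Prop, gclosed P -> P (v 0) ->
      (forall j, (j < r)%N -> P (X j)) -> forall g, P g) ->
    X 0 ^+ 2 <> 1 ->
  exists2 N, ((r + 3)`! < 2 * N)%N & at_least (fun _ : G => True) N.
Proof.
move=> r_gt1 rel full x2.
have [Bx|nBx] := boolp.EM (block r v X (X 0)); last exact: (card_not_block r_gt1
  rel x2).
have r2 : r = 2.
  apply/eqP; rewrite eqn_leq r_gt1 andbT leqNgt; apply/negP => r3.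
  exact: (block_proper r_gt1 rel x2 r3).
rewrite {r}r2 in r_gt1 rel full Bx *; exists 63 => //;
  apply: (card_five_strands rel x2).
move=> P clP Pv Pa; have PB : forall g, block 2 v X g -> P g.
  by apply: span_min => // _ [->|[[|[|j]] // _ ->]].
by move=> g; apply: full => // [[_|[|]//]]; apply: PB.
Qed.

(** * Generators and exponent sums in the braid group *)

Section Generators.
Variable n : nat.
Local Notation B := (braid n).

(** Indexed by natural numbers to avoid bounds in the indices of words. *)
Definition gen (i : nat) : B := if insub i is Some o then sigma o else 1.

Lemma genE (i : 'I_n.-1) : gen i = sigma i.
Proof. by rewrite /gen valK. Qed.

Lemma sigma_relation u v : artin_rel u v ->
  word_class (@artin_rel n) u = word_class _ v.
Proof. by move=> uv; apply/word_classP/word_eq_rel. Qed.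

Lemma word_class_cat (u v : seq ('I_n.-1 * bool)) :
  word_class (@artin_rel n) (u ++ v) = word_class _ u * word_class _ v :> B.
Proof.
apply/word_classP/word_eq_sym/word_eq_cat; exact: word_repr_class.
Qed.

Lemma word_class_cons (i : 'I_n.-1) u :
  word_class (@artin_rel n) ((i, true) :: u) = sigma i * word_class _ u :> B.
Proof. exact: (word_class_cat [:: (i, true)]). Qed.

Lemma word_class_nil : word_class (@artin_rel n) [::] = 1 :> B.
Proof. by []. Qed.

Lemma gen_artin : artin_relations n.-1 gen.
Proof.
split=> [j jn|i j ijn].
  have jn' := ltnW jn; rewrite -[j]/(val (Ordinal jn')) -[j.+1]/(val (Ordinal
    jn)).
  rewrite !genE.
  have := sigma_relation (artin_braid (erefl : val (Ordinal jn) =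
    (Ordinal jn').+1)).
  by rewrite !word_class_cons word_class_nil !mulg1 !mulgA.
have [/= jn ij] : (j < n.-1)%N /\ (i.+1 < j)%N by lia.
have iN : (i < n.-1)%N by lia.
rewrite /commute -[j]/(val (Ordinal jn)) -[i]/(val (Ordinal iN)) !genE.
have := sigma_relation (artin_comm (i := Ordinal iN) (j := Ordinal jn) _).
by rewrite !word_class_cons word_class_nil !mulg1; apply; rewrite ij.
Qed.

Lemma gen_ind P : gclosed P -> (forall i, (i < n.-1)%N -> P (gen i)) ->
  forall b : B, P b.
Proof.
move=> [P1 PM PV] Pg b; rewrite -[b]word_reprK.
elim: (word_repr b) => [|[i e] u IHu]; first exact: P1.
rewrite -cat1s word_class_cat; apply: (PM) IHu.
have Pi : P (sigma i) by rewrite -genE; apply: Pg.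
case: e => //; suff -> : word_class (@artin_rel n) [:: (i, false)] =
  (sigma i)^-1 :> B.
  exact: PV.
apply: (mulgI (sigma i)); rewrite mulgV -word_class_cons.
by apply/word_classP/(word_eq_cancel _ i true).
Qed.

Definition pos (u : seq ('I_n.-1 * bool)) := count (fun a => a.2) u.
Definition neg (u : seq ('I_n.-1 * bool)) := count (fun a => ~~ a.2) u.

(** The exponent sum, with its positive and negative part kept apart, is
    invariant. *)
Lemma exponents u v : word_eq (@artin_rel n) u v ->
  (pos u + neg v = pos v + neg u)%N.
Proof.
rewrite /pos /neg; elim=> {u v} //= [v u w _ + _|u u' v v' _ + _|x b|u v].
- by lia.
- by rewrite !count_cat; lia.
- by case: b.
by case.
Qed.

(** The exponent sum of b is p - m, written without subtraction. *)
Definition degree_is (b : B) p m :=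
  (pos (word_repr b) + m = p + neg (word_repr b))%N.

Lemma degree_is_word u : degree_is (word_class _ u) (pos u) (neg u).
Proof. exact: exponents (word_repr_class _ _). Qed.

Lemma degree_ex b : exists p m, degree_is b p m.
Proof. by exists (pos (word_repr b)), (neg (word_repr b)). Qed.

Lemma degree_unique b p m p' m' :
  degree_is b p m -> degree_is b p' m' -> (p + m' = p' + m)%N.
Proof. by rewrite /degree_is; lia. Qed.

Lemma degreeM b b' p m p' m' :
  degree_is b p m -> degree_is b' p' m' -> degree_is (b * b') (p + p') (m + m').
Proof.
move=> dp dp'; have := degree_is_word (word_repr b ++ word_repr b').
rewrite word_class_cat !word_reprK /degree_is in dp dp' *.
rewrite [pos (_ ++ _)]count_cat [neg (_ ++ _)]count_cat -!/(pos _) -!/(neg _).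
by move: (pos _) (neg _) (pos _) (neg _) (pos _) (neg _) dp dp' => *; lia.
Qed.

Lemma degree1 : degree_is 1 0 0.
Proof. exact: (degree_is_word [::]). Qed.

Lemma degreeV b p m : degree_is b p m -> degree_is b^-1 m p.
Proof.
have [p' [m' dV]] := degree_ex b^-1 => d.
have := degree_unique (degreeM d dV); rewrite mulgV => /(_ _ _ degree1).
by rewrite /degree_is in dV *; lia.
Qed.

Lemma degree_gen i : (i < n.-1)%N -> degree_is (gen i) 1 0.
Proof.
by move=> iN; rewrite -[i]/(val (Ordinal iN)) genE;
  apply: (degree_is_word [:: (_, true)]).
Qed.

Lemma degreeX b p m k : degree_is b p m -> degree_is (b ^+ k) (p * k) (m * k).
Proof.
move=> d; elim: k => [|k IHk]; first by rewrite !muln0; apply: degree1.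
by rewrite expgS !mulnS; apply: degreeM.
Qed.

Lemma degree_derived b : in_derived b -> degree_is b 0 0.
Proof.
elim=> {b} [|x y|x y _ dx _ dy|x _ dx].
- exact: degree1.
- have [p [m dx]] := degree_ex x; have [p' [m' dy]] := degree_ex y.
  have := degreeM (degreeM (degreeV dx) (degreeV dy)) (degreeM dx dy).
  have -> : x^-1 * y^-1 * (x * y) = [~ x, y] by rewrite commgEl conjgE !gnorm.
  by rewrite /degree_is; lia.
- exact: (degreeM dx dy).
exact: (degreeV dx).
Qed.

End Generators.

(** * Coxeter's presentation of the symmetric group *)

Section Coxeter.
Variable n : nat.
Local Notation B := (braid n).
Local Notation s := (gen n).

Definition square_conj (b : B) : Prop :=
  exists (g : B) (i : 'I_n.-1), b = g * (s i * s i) * g^-1.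
Definition squares : B -> Prop := span square_conj.

Lemma squares_conj g b : squares b -> squares (g * b * g^-1).
Proof.
elim=> {b} [_ [h [i ->]]||x y _ Kx _ Ky|x _ Kx].
- by apply: span_gen; exists (g * h), i; rewrite !gnorm.
- by rewrite mulg1 mulgV; apply: span1.
- have -> : g * (x * y) * g^-1 = (g * x * g^-1) * (g * y * g^-1)
  by rewrite !gnorm.
  exact: spanM.
have -> : g * x^-1 * g^-1 = (g * x * g^-1)^-1 by rewrite !gnorm.
exact: spanV.
Qed.

Lemma squares_gen i : (i < n.-1)%N -> squares (s i * s i).
Proof.
by move=> iN; apply: span_gen; exists 1, (Ordinal iN);
  rewrite mul1g invg1 mulg1.
Qed.

Definition parabolic m : B -> Prop := span (fun b => exists2 i, (i < m)%N & b =
  s i).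

Lemma parabolic_gen m i : (i < m)%N -> parabolic m (s i).
Proof. by move=> im; apply: span_gen; exists i. Qed.

Local Notation run := (run s).

(** Normal form modulo squares: the runs s_j ... s_m, for j <= m + 1, represent
    the cosets of the subgroup generated by s_0, ..., s_(m-1) in the one
    generated by s_0, ..., s_m. *)
Definition run_form m (b : B) := exists k j w,
  [/\ squares k, (j <= m.+1)%N, parabolic m w & b = k * run j (m.+1 - j) * w].

(** The generator s_i commutes with the run if i + 1 < j, extends it if i + 1 =
    j, shortens it modulo squares if i = j, and passes through as s_(i-1) if i >
    j. *)
Lemma run_form_gen m i b : (m < n.-1)%N -> (i <= m)%N ->
  run_form m b -> run_form m (s i * b).
Proof.
move=> mn im [k [j [w [Kk jm Pw ->]]]].
have KK : squares (s i * k * (s i)^-1) by apply: squares_conj.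
have -> : s i * (k * run j (m.+1 - j) * w) =
   (s i * k * (s i)^-1) * (s i * run j (m.+1 - j)) * w by rewrite !gnorm.
move: (s i * k * _) KK => {Kk}k Kk.
have [ij|ji] := ltnP i j.
  have [ij1|ji1] := ltnP i.+1 j.
    exists k, j, (s i * w); split=> //; first by apply: spanM => //;
      apply: parabolic_gen; lia.
    have -> : s i * run j (m.+1 - j) = run j (m.+1 - j) * s i.
      apply: (run_commute (r := n.-1)); first by lia.
      by move=> l jl; apply: (rel_comm (gen_artin n)); lia.
    by rewrite !mulgA.
  have {ij ji1 jm}-> : j = i.+1 by lia.
  exists k, i, w; split=> //; first by lia.
  by rewrite [(m.+1 - i)%N]subSn // run_cons subSS.
move: ji; rewrite leq_eqVlt => /predU1P[ji|ji].
  rewrite {}ji subSn // run_cons in jm *.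
  exists (k * (s i * s i)), i.+1, w; split=> //.
    by apply: spanM => //; apply: squares_gen; lia.
  by rewrite subSS !mulgA.
case: i im ji => // i im ji {jm}.
exists k, j, (s i * w); split=> //.
- by lia.
- by apply: spanM => //; apply: parabolic_gen; lia.
have -> : (m.+1 - j = (m - j).+1)%N by lia.
by rewrite -(run_shift (gen_artin n)) ?mulgA //; lia.
Qed.

Lemma run_form_genV m i b : (m < n.-1)%N -> (i <= m)%N ->
  run_form m b -> run_form m ((s i)^-1 * b).
Proof.
move=> mn im [k [j [w [Kk jm Pw ->]]]].
have -> : (s i)^-1 * (k * run j (m.+1 - j) * w) =
   s i * ((s i * s i)^-1 * k * run j (m.+1 - j) * w) by rewrite !gnorm.
apply: run_form_gen => //; exists ((s i * s i)^-1 * k), j, w; split=> //.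
by apply: spanM => //; apply/spanV/squares_gen; lia.
Qed.

Lemma parabolic_run_form m b : (m < n.-1)%N -> parabolic m.+1 b -> run_form m b.
Proof.
move=> mn Pb; rewrite -[b]mulg1.
have: run_form m 1.
  exists 1, m.+1, 1; split=> //; [exact: span1|exact: span1|].
  by rewrite subnn !mulg1.
suff [] : (forall c, run_form m c -> run_form m (b * c)) /\
          (forall c, run_form m c -> run_form m (b^-1 * c)) by move=> + _;
            apply.
elim: Pb => {b} [_ [i im ->]||x y _ [x1 x2] _ [y1 y2]|x _ [x1 x2]].
- by split=> c; [apply: run_form_gen|apply: run_form_genV].
- by split=> c; rewrite ?invg1 mul1g.
- by split=> c Fc; rewrite ?invgM -mulgA; [apply/x1/y1|apply/y2/x2].
by split; rewrite ?invgK.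
Qed.

Lemma perm_gen_lt i (x : 'I_n) : (i < n.-1)%N -> (i.+1 < x)%N ->
  braid_perm (s i) x = x.
Proof.
move=> iN ix; rewrite -[i]/(val (Ordinal iN)) genE braid_permP.
by apply: tpermD; rewrite -val_eqE /=; lia.
Qed.

Lemma perm_gen_val i (x : 'I_n) : (i < n.-1)%N -> x = i :> nat ->
  braid_perm (s i) x = i.+1 :> nat.
Proof.
move=> iN xi; rewrite -[X in gen n X]/(val (Ordinal iN)) genE braid_permP
  /transposition.
by set u := Ordinal _; rewrite (_ : x = u) ?tpermL //; apply: val_inj.
Qed.

Lemma perm_run j l (x : 'I_n) : (j + l < n)%N -> x = j :> nat ->
  braid_perm (run j l) x = (j + l)%N :> nat.
Proof.
elim: l => [|l IHl] jl xj /=; first by rewrite gmulf1 perm1 xj addn0.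
rewrite gmulfM permM (perm_gen_val (i := j + l)) ?addnS //; first by lia.
by apply: IHl => //; lia.
Qed.

Lemma perm_parabolic m w (x : 'I_n) : (m <= n.-1)%N -> parabolic m w ->
  (m < x)%N -> braid_perm w x = x.
Proof.
move=> mn Pw mx; elim: Pw => {w} [_ [i im ->]||y z _ Hy _ Hz|y _ Hy].
- by apply: perm_gen_lt; lia.
- by rewrite gmulf1 perm1.
- by rewrite gmulfM permM /= Hy.
by rewrite gmulfV; apply: (perm_inj (s := braid_perm y)); rewrite permKV Hy.
Qed.

Lemma perm_squares k : squares k -> braid_perm k = 1.
Proof.
elim=> {k} [_ [g [i ->]]||y z _ Hy _ Hz|y _ Hy].
- rewrite !gmulfM gmulfV /= genE braid_permP.
  by rewrite /transposition tperm2 mulg1 mulgV.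
- exact: gmulf1.
- by rewrite gmulfM /= Hy Hz mulg1.
by rewrite gmulfV /= Hy invg1.
Qed.

(** The run s_j ... s_m takes the point j to m + 1, which the parabolic factor
    fixes. So a braid with trivial permutation has j = m + 1, the empty run. *)
Lemma parabolic_kernel_squares m b : (m <= n.-1)%N -> parabolic m b ->
  braid_perm b = 1 -> squares b.
Proof.
elim: m b => [|m IHm] b mn Pb b1.
  by elim: Pb {b1} => {b} [_ [i //]||y z _ Hy _ Hz|y _ Hy];
    [apply: span1|apply: spanM|apply: spanV].
have [k [j [w [Kk jm Pw Eb]]]] := parabolic_run_form mn Pb.
have jn : (j < n)%N by lia.
have wk : squares (k^-1 * b) -> squares b.
  by move=> /(spanM Kk); rewrite mulKVg.
have : braid_perm b (Ordinal jn) = j :> nat by rewrite b1 perm1.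
rewrite {1}Eb !gmulfM /= (perm_squares Kk) mul1g permM.
have run_j : braid_perm (run j (m.+1 - j)) (Ordinal jn) = m.+1 :> nat.
  by rewrite (perm_run (j := j)) //= subnKC //; lia.
rewrite (perm_parabolic (ltnW mn) Pw) ?run_j // => Ej.
have Ebk : k^-1 * b = w by rewrite Eb -Ej subnn mulg1 mulKg.
apply: wk; rewrite Ebk; apply: IHm => //; first exact: ltnW.
by rewrite -Ebk gmulfM gmulfV /= b1 mulg1 (perm_squares Kk) invg1.
Qed.

Theorem perm_kernel_squares b : braid_perm b = 1 -> squares b.
Proof.
apply: (parabolic_kernel_squares (leqnn _)).
by apply: gen_ind => [|i iN]; [exact: span_closed|exact: parabolic_gen].
Qed.

End Coxeter.

(** * The commutator subgroup and its quotients *)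

Section Derived.
Variable B : groupType.
Local Notation D := (@in_derived B).

Lemma derived_gclosed : gclosed D.
Proof. by split; [exact: in_derived1|exact: in_derivedM|exact: in_derivedV].
  Qed.

Lemma derived_conjV g x : D (g * x * g^-1 * x^-1).
Proof.
have -> : g * x * g^-1 * x^-1 = [~ g^-1, x^-1] by rewrite commgEl conjgE !gnorm.
exact: in_derivedR.
Qed.

Lemma derived_conj g x : D x -> D (g * x * g^-1).
Proof.
move=> Dx; rewrite -[_ * g^-1](mulgVK x); apply: in_derivedM Dx.
exact: derived_conjV.
Qed.
End Derived.

Section Quotient.
Variables (n : nat) (G : groupType) (q : group_hom (braid' n) G).
Hypothesis n_gt4 : (4 < n)%N.
Local Notation B := (braid n).
Local Notation s := (gen n).
Local Notation D := (@in_derived B).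

(** Total version of q, with a junk value outside of the commutator subgroup. *)
Definition qbar (b : B) : G :=
  if insub b is Some d then q (d : braid' n) else 1.

Lemma qbar_val (d : braid' n) : qbar (derived_val d) = q d.
Proof. by rewrite /qbar valK. Qed.

Lemma derived_ex b : D b -> exists d : braid' n, derived_val d = b.
Proof. by move=> Db; exists (Derived (asboolT Db)). Qed.

Lemma qbarM x y : D x -> D y -> qbar (x * y) = qbar x * qbar y.
Proof.
move=> /derived_ex[d <-] /derived_ex[e <-].
by rewrite -derived_valM !qbar_val gmulfM.
Qed.

Lemma qbar1 : qbar 1 = 1.
Proof. by rewrite -(derived_val1 (braid n)) qbar_val gmulf1. Qed.

Lemma qbarV x : D x -> qbar x^-1 = (qbar x)^-1.
Proof.
move=> Dx; apply: (mulgI (qbar x)); rewrite mulgV -qbarM ?mulgV ?qbar1 //.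
exact: in_derivedV.
Qed.

Lemma gen_ratio_derived i : (i < n.-1)%N -> D (s i * (s 0)^-1).
Proof.
elim: i => [|i IHi] iN; first by rewrite mulgV; apply: in_derived1.
have := braid_conj (rel_braid (gen_artin n) iN); set g := s i * _ => E.
have := derived_conjV g (s i); rewrite E => D1.
have := in_derivedM D1 (IHi (ltnW iN)).
by rewrite mulgA mulgVK.
Qed.

Lemma gen_ratio i j : (i < n.-1)%N -> (j < n.-1)%N -> D (s i * (s j)^-1).
Proof.
move=> iN jN; have := in_derivedM (gen_ratio_derived iN) (in_derivedV
  (gen_ratio_derived jN)).
by rewrite invgM invgK mulgA mulgVK.
Qed.

(** In particular, the braid group is generated by its commutator subgroup and
    any one of the generators. *)
Lemma gen_factor (M : B -> Prop) (t : B) : gclosed M ->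
    (forall x, M x -> M (t * x * t^-1) /\ M (t^-1 * x * t)) ->
    (forall i, (i < n.-1)%N -> M (s i * t^-1)) ->
  forall g, exists m c, [/\ M m, span (fun x => x = t) c & g = m * c].
Proof.
move=> [M1 MM MV] Mt Ms.
have Mc c : span (fun x => x = t) c -> forall x, M x -> M (c * x * c^-1) /\
  M (c^-1 * x * c).
  elim=> {c} [_ -> //||c d _ Hc _ Hd x Mx|c _ Hc x /Hc[]]; last
    by rewrite invgK.
    by move=> x Mx; rewrite !gnorm.
  have [/Hc[C1 _] _] := Hd _ Mx; have [_ /Hd[_ C2]] := Hc _ Mx.
  by rewrite !gnorm in C1 C2 *.
apply: gen_ind; last first.
  move=> i iN; exists (s i * t^-1), t; split; [exact: Ms|exact: span_gen|].
  by rewrite mulgVK.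
split=> [|x y [m [c [Mm Cc ->]]] [m' [c' [Mm' Cc' ->]]]|x [m [c [Mm Cc ->]]]].
- by exists 1, 1; rewrite mulg1; split=> //; apply: span1.
- exists (m * (c * m' * c^-1)), (c * c'); split; last by rewrite !gnorm.
    by apply: (MM) => //; have [] := Mc c Cc m' Mm'.
  exact: spanM.
exists (c^-1 * m^-1 * c), c^-1; split; last by rewrite !gnorm.
  by have [] := Mc c Cc m^-1 (MV _ Mm).
exact: spanV.
Qed.

Definition braid_v k : B := s 0 ^+ k * (s 1 * (s 0)^-1) * (s 0 ^+ k)^-1.
Definition braid_X j : B := s j.+2 * (s 0)^-1.

Local Notation r := (n - 3)%N.

Lemma braid_v_derived k : D (braid_v k).
Proof. by apply/derived_conj/gen_ratio_derived; lia. Qed.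

Lemma braid_X_derived j : (j < r)%N -> D (braid_X j).
Proof. by move=> jr; apply: gen_ratio_derived; lia. Qed.

Local Notation v := (fun k => qbar (braid_v k)).
Local Notation X := (fun j => qbar (braid_X j)).

Let s01 : s 0 * s 1 * s 0 = s 1 * s 0 * s 1.
Proof. by apply: (rel_braid (gen_artin n)); lia. Qed.

Let comm i j : (i.+1 < j)%N -> (j < n.-1)%N -> commute (s i) (s j).
Proof. by move=> ij jn; apply: (rel_comm (gen_artin n)); lia. Qed.

Lemma braid_X_s0 j : (j < r)%N -> commute (s 0) (braid_X j).
Proof.
move=> jr; apply: commuteM; first by apply: comm; lia.
exact/commuteV/commute_refl.
Qed.

Lemma braid_vS k : braid_v k.+1 = s 0 * braid_v k * (s 0)^-1.
Proof. by rewrite /braid_v expgS invgM !mulgA. Qed.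

Lemma braid_relations_X j : (j.+1 < r)%N ->
  braid_X j * braid_X j.+1 * braid_X j = braid_X j.+1 * braid_X j * braid_X
    j.+1.
Proof.
move=> jr; have b : s j.+2 * s j.+3 * s j.+2 = s j.+3 * s j.+2 * s j.+3.
  by apply: (rel_braid (gen_artin n)); lia.
have c2 : commute (s 0)^-1 (s j.+2) by
  apply/commute_sym/commuteV/commute_sym/comm; lia.
have c3 : commute (s 0)^-1 (s j.+3) by
  apply/commute_sym/commuteV/commute_sym/comm; lia.
rewrite /braid_X; move: (s j.+2) (s j.+3) (s 0)^-1 b c2 c3 => x y z b c2 c3.
have E x' y' : commute z x' -> commute z y' -> x' * z * (y' * z) * (x' * z) =
  x' * y' * x' * (z * z * z).
  move=> cx cy; rewrite !mulgA -(mulgA x' z y') cy !mulgA -(mulgA _ z x') cx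
    !mulgA.
  by rewrite -(mulgA _ z x') cx !mulgA.
by rewrite !E // b.
Qed.

Lemma gen_braid_v i k : (2 < i)%N -> (i < n.-1)%N -> commute (s i) (braid_v k).
Proof.
move=> i2 iN; have c0 : commute (s i) (s 0) by apply/commute_sym/comm; lia.
have c1 : commute (s i) (s 1) by apply/commute_sym/comm; lia.
by do ?[apply: commuteM | apply: commuteV | apply: commuteX].
Qed.

Lemma braid_relations_vX k j : (0 < j < r)%N -> braid_v k * braid_X j =
  braid_X j * braid_v k.+1.
Proof.
move=> jr; rewrite braid_vS /braid_X mulgA -(gen_braid_v k (i :=
  j.+2)) ?gnorm //; lia.
Qed.

Lemma braid_relations_vX0 k : braid_v k * braid_X 0 * braid_v k.+2 =
  braid_X 0 * braid_v k.+1 * braid_X 0.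
Proof.
have s12 : s 1 * s 2 * s 1 = s 2 * s 1 * s 2.
  by apply: (rel_braid (gen_artin n)); lia.
have c02 : commute (s 0) (s 2) by apply: comm; lia.
have cp : commute (s 0 ^+ k)^-1 (s 2) by
  apply/commute_sym/commuteV/commuteX/commute_sym.
have c02V : commute (s 0)^-1 (s 2) by apply/commute_sym/commuteV/commute_sym.
have cc : commute (s 0)^-1 (s 0 ^+ k) by
  apply/commute_sym/commuteV/commute_sym/commuteX/commute_refl.
rewrite /braid_v /braid_X !expgSr; move: (s 0 ^+ k) cp cc => p cp cc.
move: (s 0) (s 1) (s 2) s12 c02V cp cc {c02} => a b c s12 c02V cp cc.
have E1 : p^-1 * (c * a^-1) * p = c * a^-1.
  by rewrite mulgA cp -!mulgA cc mulKg.
have E2 : a^-1 * c * a = c by rewrite c02V mulgVK.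
have -> : p * (b * a^-1) * p^-1 * (c * a^-1) * (p * a * a * (b * a^-1) * (p * a
  * a)^-1)
   = p * b * a^-1 * (p^-1 * (c * a^-1) * p) * a * a * b * a^-1 * a^-1 * a^-1 *
     p^-1.
  by rewrite !gnorm.
have -> : c * a^-1 * (p * a * (b * a^-1) * (p * a)^-1) * (c * a^-1) =
  p * (p^-1 * (c * a^-1) * p) * a * b * a^-1 * a^-1 * (p^-1 * (c * a^-1) * p) *
      p^-1.
  by rewrite !gnorm.
rewrite E1.
have -> : p * b * a^-1 * (c * a^-1) * a * a * b * a^-1 * a^-1 * a^-1 * p^-1 =
   p * b * (a^-1 * c * a) * b * a^-1 * a^-1 * a^-1 * p^-1 by rewrite !gnorm.
rewrite E2.
have E3 : a^-1 * a^-1 * c = c * a^-1 * a^-1 by rewrite -mulgA c02V mulgA c02V.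
have -> : p * (c * a^-1) * a * b * a^-1 * a^-1 * (c * a^-1) * p^-1 =
   p * c * b * (a^-1 * a^-1 * c) * a^-1 * p^-1 by rewrite !gnorm.
rewrite E3; by_relation p s12.
Qed.

Theorem quotient_relations : braid'_relations r v X.
Proof.
have DM := @in_derivedM B.
split=> [|k|k|k j jr].
- split=> [j jr|i j ijr].
    have DXj : D (braid_X j) by apply: braid_X_derived; lia.
    have DXj1 : D (braid_X j.+1) by apply: braid_X_derived.
    by rewrite -!qbarM; do ?[exact: DXj | exact: DXj1 | apply: (DM)];
      rewrite braid_relations_X.
  have DXi : D (braid_X i) by apply: braid_X_derived; lia.
  have DXj : D (braid_X j) by apply: braid_X_derived; lia.
  rewrite /commute -!qbarM //; congr qbar.
  have c0 : commute (s 0) (braid_X j) by apply: braid_X_s0; lia.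
  rewrite -/(commute _ _); apply/commute_sym; apply: commuteM.
    apply/commute_sym; apply: commuteM; first by apply: comm; lia.
    by apply/commuteV/commute_sym/comm; lia.
  exact/commuteV/commute_sym.
- rewrite -qbarM; [|exact: braid_v_derived..]; congr qbar.
  by rewrite /braid_v !expgSr; move: (s 0 ^+ k) => p; by_relation p s01.
- have DX : D (braid_X 0) by apply: braid_X_derived; lia.
  have Dv := braid_v_derived.
  rewrite -!qbarM; do ?[exact: DX | exact: Dv | apply: (DM)]; congr qbar.
  exact: braid_relations_vX0.
have jr' : (j < r)%N by lia.
rewrite -!qbarM; do ?[exact: braid_X_derived | exact: braid_v_derived];
  congr qbar.
exact: braid_relations_vX.
Qed.

Hypothesis q_surj : forall g : G, exists b : braid' n, q b = g.

Lemma qbar_surj g : exists2 b, D b & g = qbar b.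
Proof.
have [d <-] := q_surj g; exists (derived_val d); last by rewrite qbar_val.
exact/asboolP/(derived_valP d).
Qed.

Local Notation C := (span (fun x => x = s 0)).

(** A subgroup M that is normalised by s_0 and contains all the s_i s_0^-1 is
    normal with cyclic quotient, so it contains all commutators. *)
Lemma derived_in_normal (M : B -> Prop) : gclosed M ->
    (forall c x, C c -> M x -> M (c * x * c^-1)) ->
    (forall i, (i < n.-1)%N -> M (s i * (s 0)^-1)) ->
  forall b, D b -> M b.
Proof.
move=> clM Mc Ms; have [M1 MM MV] := clM.
have Cs : C (s 0) by apply: span_gen.
have McV c x : C c -> M x -> M (c^-1 * x * c).
  by move=> Cc Mx; rewrite -{2}[c]invgK; apply: (Mc) Mx; apply: spanV.
have C_comm c d : C c -> C d -> commute c d.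
  move=> Cc; move: d; apply: span_min (centraliser_closed c) _ => _ ->.
  apply: commute_sym; move: c Cc; apply: span_min (centraliser_closed _) _ =>
    _ ->.
  exact: commute_refl.
have Ms0 x : M x -> M (s 0 * x * (s 0)^-1) /\ M ((s 0)^-1 * x * s 0).
  by move=> Mx; split; [apply: Mc | apply: McV].
move=> b; elim=> {b} // [x y|x y _ Mx _ My|x _ Mx]; [|exact: (MM)|exact: (MV)].
have [m [c [Mm Cc ->]]] := gen_factor clM Ms0 Ms x.
have [m' [c' [Mm' Cc' ->]]] := gen_factor clM Ms0 Ms y.
have cc : c * c' = c' * c by apply: C_comm.
have -> : [~ m * c, m' * c'] =
    (c^-1 * m^-1 * c) * (c^-1 * (c'^-1 * (m'^-1 * m) * c') * c) * (c'^-1 * m' *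
        c').
  have ccV : c^-1 * c'^-1 * c = c'^-1 by rewrite -invgM -cc invgM mulgVK.
  rewrite commgEl conjgE.
  have -> : c^-1 * (c'^-1 * (m'^-1 * m) * c') * c =
    c^-1 * c'^-1 * m'^-1 * m * (c' * c).
    by rewrite !gnorm.
  rewrite -cc.
  have -> : c'^-1 * m' * c' = c'^-1 * c^-1 * c * m' * c' by rewrite !gnorm.
  by rewrite !gnorm.
apply: (MM); first apply: (MM).
- by apply: McV => //; apply: MV.
- by apply: (McV) => //; apply: (McV) => //; apply: (MM) => //; apply: (MV).
exact: McV.
Qed.

(** Conjugation by s_0 on v_0 can be replaced by conjugation by X_1^-1, whose
    image is in P, because s_3 commutes with v_0. *)
Lemma braid_v0_conj (P : G -> Prop) : gclosed P -> P (qbar (braid_X 1)) ->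
  forall c, C c -> exists e,
    [/\ D e, P (qbar e), commute (s 0) e & c * braid_v 0 * c^-1 =
      e * braid_v 0 * e^-1].
Proof.
move=> [P1 PM PV] PX.
have DX : D (braid_X 1) by apply: braid_X_derived; lia.
have cX : commute (s 0) (braid_X 1) by apply: braid_X_s0; lia.
have C_comm c e : C c -> commute (s 0) e -> commute e c.
  by move=> + ce; move: c; apply: span_min (centraliser_closed e) _ => _ ->.
move=> c; elim=> {c} [_ ->||c d Cc [e [De Pe ce Ee]] Cd [f [Df Pf cf Ef]]|c Cc
  [e [De Pe ce Ee]]].
- exists (braid_X 1)^-1; split.
  + exact: in_derivedV.
  + by rewrite qbarV //; apply: PV.
  + exact: commuteV.
  rewrite -braid_vS invgK -mulgA braid_relations_vX ?mulKg //; lia.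
- by exists 1; split; rewrite ?qbar1 //; [exact: in_derived1 | exact: commute1].
- exists (f * e); split.
  + exact: in_derivedM.
  + by rewrite qbarM //; apply: PM.
  + exact: commuteM.
  have fc : f * c = c * f by apply: C_comm.
  move: (braid_v 0) Ee Ef => b Ee Ef.
  have -> : c * d * b * (c * d)^-1 = c * (d * b * d^-1) * c^-1
    by rewrite !gnorm.
  rewrite Ef; have -> : c * (f * b * f^-1) * c^-1 = (c * f) * b * (c * f)^-1
    by rewrite !gnorm.
  rewrite -fc; have -> : f * c * b * (f * c)^-1 = f * (c * b * c^-1) * f^-1
    by rewrite !gnorm.
  by rewrite Ee !gnorm.
exists e^-1; split.
+ exact: in_derivedV.
+ by rewrite qbarV //; apply: PV.
+ exact: commuteV.
have ec : e^-1 * c = c * e^-1 by apply: commute_sym;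
  apply/commuteV/commute_sym/C_comm.
move: (braid_v 0) Ee => b Ee.
have {}Ee : b = (e^-1 * c) * b * (e^-1 * c)^-1.
  have -> : (e^-1 * c) * b * (e^-1 * c)^-1 = e^-1 * (c * b * c^-1) * e
    by rewrite !gnorm.
  by rewrite Ee !gnorm.
by rewrite {1}Ee ec !gnorm.
Qed.

(** Apply [derived_in_normal] to the elements all of whose conjugates by powers
    of s_0 are mapped into P. *)
Theorem quotient_full (P : G -> Prop) : gclosed P -> P (v 0) ->
  (forall j, (j < r)%N -> P (X j)) -> forall g, P g.
Proof.
move=> clP Pv PX g; have [P1 PM PV] := clP.
pose M b := D b /\ forall c, C c -> P (qbar (c * b * c^-1)).
have C1 : C 1 by apply: span1.
suff DM : forall b, D b -> M b.
  have [b Db ->] := qbar_surj g.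
  by have [_ /(_ 1 C1)] := DM b Db; rewrite mul1g invg1 mulg1.
apply: derived_in_normal.
- split=> [|x y [Dx Px] [Dy Py]|x [Dx Px]].
  + by split=> [|c _]; [exact: in_derived1 | rewrite mulg1 mulgV qbar1].
  + split=> [|c Cc]; first exact: in_derivedM.
    have -> : c * (x * y) * c^-1 = (c * x * c^-1) * (c * y * c^-1)
      by rewrite !gnorm.
    by rewrite qbarM; [apply: PM; auto | apply: derived_conj..].
  split=> [|c Cc]; first exact: in_derivedV.
  have -> : c * x^-1 * c^-1 = (c * x * c^-1)^-1 by rewrite !gnorm.
  by rewrite qbarV; [apply: PV; auto | apply: derived_conj].
- move=> c x Cc [Dx Px]; split=> [|d Cd]; first exact: derived_conj.
  have -> : d * (c * x * c^-1) * d^-1 = (d * c) * x * (d * c)^-1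
    by rewrite !gnorm.
  by apply: Px; apply: spanM.
move=> i iN; split=> [|c Cc]; first exact: gen_ratio_derived.
case: i iN => [|[|j]] jN.
- by rewrite mulgV mulg1 mulgV qbar1.
- have PX1 : P (qbar (braid_X 1)) by apply: PX; lia.
  have [e [De Pe _]] := braid_v0_conj clP PX1 Cc.
  have -> : braid_v 0 = s 1 * (s 0)^-1 by rewrite /braid_v expg0 mul1g invg1
    mulg1.
  move=> ->; have Dv : D (s 1 * (s 0)^-1) by apply: gen_ratio_derived.
  have DeV := in_derivedV De; rewrite (qbarM (in_derivedM De Dv) DeV) (qbarM De
    Dv) qbarV //.
  apply: (PM); last exact: (PV).
  by apply: (PM) => //; move: Pv; rewrite /braid_v expg0 mul1g invg1 mulg1.
have jr : (j < r)%N by lia.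
have -> : c * (s j.+2 * (s 0)^-1) * c^-1 = braid_X j; last exact: PX.
suff cX : commute (braid_X j) c by rewrite -/(braid_X j) -cX mulgK.
move: c Cc; apply: span_min (centraliser_closed _) _ => _ ->.
exact/commute_sym/braid_X_s0.
Qed.

End Quotient.

(** * Quotients in which the square of X_0 is trivial *)

Section SquareCase.
Variables (n : nat) (G : groupType) (q : group_hom (braid' n) G).
Hypothesis n_gt4 : (4 < n)%N.
Local Notation B := (braid n).
Local Notation s := (gen n).
Local Notation D := (@in_derived B).
Local Notation qbar := (qbar q).

Definition normal_kernel (z : B) : Prop := D z /\
  forall g, qbar (g * z * g^-1) = 1.
Local Notation L := normal_kernel.

Lemma normal_kernel_closed : gclosed L.
Proof.
split=> [|x y [Dx Lx] [Dy Ly]|x [Dx Lx]].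
- by split=> [|g]; [exact: in_derived1 | rewrite mulg1 mulgV qbar1].
- split=> [|g]; first exact: in_derivedM.
  have -> : g * (x * y) * g^-1 = (g * x * g^-1) * (g * y * g^-1)
    by rewrite !gnorm.
  by rewrite qbarM ?Lx ?Ly ?mulg1 //; apply: derived_conj.
split=> [|g]; first exact: in_derivedV.
have -> : g * x^-1 * g^-1 = (g * x * g^-1)^-1 by rewrite !gnorm.
by rewrite qbarV ?Lx ?invg1 //; apply: derived_conj.
Qed.

Lemma normal_kernel_conj g z : L z -> L (g * z * g^-1).
Proof.
move=> [Dz Lz]; split=> [|h]; first exact: derived_conj.
by have -> : h * (g * z * g^-1) * h^-1 = (h * g) * z * (h * g)^-1;
  rewrite ?Lz // !gnorm.
Qed.

(** Write g = d c with d in the commutator subgroup and c a power of s_i. Then c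
    centralises z, and q is multiplicative on the conjugation by d. *)
Lemma normal_kernel_gen z i : (i < n.-1)%N -> D z -> qbar z = 1 ->
  commute (s i) z -> L z.
Proof.
move=> iN Dz qz cz; split=> // g.
have Dclosed := @derived_gclosed B.
have Di x : D x -> D (s i * x * (s i)^-1) /\ D ((s i)^-1 * x * s i).
  move=> Dx; split; first exact: derived_conj.
  by rewrite -{2}[s i]invgK; apply: derived_conj.
have Ds j : (j < n.-1)%N -> D (s j * (s i)^-1) by move=> jN; apply: gen_ratio.
have [d [c [Dd Cc ->]]] := gen_factor Dclosed Di Ds g.
have zc : commute z c.
  move: c Cc; apply: span_min (centraliser_closed z) _ => _ ->;
    exact: commute_sym.
have -> : d * c * z * (d * c)^-1 = d * (c * z * c^-1) * d^-1 by rewrite !gnorm.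
rewrite -zc mulgK qbarM ?qbarM ?qbarV //; [|exact: in_derivedM|exact:
  in_derivedV].
by rewrite qz mulg1 mulgV.
Qed.

Hypothesis X2 : qbar (braid_X n 0) ^+ 2 = 1.

Let comm i j : (i.+1 < j)%N -> (j < n.-1)%N -> commute (s i) (s j).
Proof. by move=> ij jn; apply: (rel_comm (gen_artin n)); lia. Qed.

Let square i : B := s i * s i.

Definition same_square i j := L (square i * (square j)^-1).

Lemma same_square_trans j i k : same_square i j -> same_square j k ->
  same_square i k.
Proof.
have [_ LM _] := normal_kernel_closed => ij jk.
by have := LM _ _ ij jk; rewrite mulgA mulgVK.
Qed.

Lemma same_square_sym i j : same_square i j -> same_square j i.
Proof.
have [_ _ LV] := normal_kernel_closed => ij.
by have := LV _ ij; rewrite invgM invgK.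
Qed.

Lemma same_square_conj g i j i' j' : g * s i * g^-1 = s i' -> g * s j * g^-1 =
  s j' ->
  same_square i j -> same_square i' j'.
Proof.
move=> gi gj /(normal_kernel_conj g); rewrite /same_square /square -gi -gj.
by rewrite !gnorm.
Qed.

Lemma same_square20 : same_square 2 0.
Proof.
have c : commute (s 0) (s 2) by apply: comm; lia.
have D2 : D (braid_X n 0) by apply: braid_X_derived; lia.
have E : square 2 * (square 0)^-1 = braid_X n 0 * braid_X n 0.
  rewrite /square /braid_X -!mulgA; congr (_ * _); rewrite invgM !mulgA;
    congr (_ * _).
  by rewrite (commute_sym (commuteV (commute_sym c))).
apply: (normal_kernel_gen (i := 0)).
- by lia.
- by rewrite E; apply: in_derivedM.
- by rewrite E qbarM // -expg2.
by rewrite E; apply: commuteM; apply: braid_X_s0 => //; lia.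
Qed.

Lemma same_square_ge2 j : (1 < j)%N -> (j < n.-1)%N -> same_square j 0.
Proof.
elim: j => // j IHj; rewrite ltnS leq_eqVlt => /predU1P[<- _|j1 jN];
  first exact: same_square20.
apply: (@same_square_conj (s j * s j.+1)) (IHj j1 (ltnW jN)).
  by apply: braid_conj; apply: (rel_braid (gen_artin n)).
have c0 : commute (s 0) (s j * s j.+1) by apply: commuteM; apply: comm; lia.
by rewrite -c0 mulgK.
Qed.

(** Conjugation by s_0 s_1 s_2 s_3 takes s_0, s_2 to s_1, s_3, so s_1^2 is
    compared with s_3^2 first. *)
Lemma same_square0 j : (j < n.-1)%N -> same_square j 0.
Proof.
case: j => [|[|j]] jN; last exact: same_square_ge2.
  by rewrite /same_square mulgV; have [] := normal_kernel_closed.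
apply: (same_square_trans (j := 3)); last by apply: same_square_ge2; lia.
apply: same_square_sym.
pose g := run s 0 4.
have shift i : (i < 3)%N -> g * s i * g^-1 = s i.+1.
  by move=> i3; rewrite /g (run_shift (gen_artin n)) ?mulgK //; lia.
by apply: (same_square_conj (g := g)) same_square20; apply: shift.
Qed.

Local Notation zeta := (square 0).

(** Modulo the kernel, zeta is s_i^2, which commutes with s_i, for every i. *)
Lemma zeta_central_mod g : L (g * zeta * g^-1 * zeta^-1).
Proof.
have [L1 LM LV] := normal_kernel_closed.
move: g; apply: gen_ind => [|i iN].
- split=> [|x y Lx Ly|x Lx].
  + by rewrite mul1g invg1 mulg1 mulgV.
  + have -> : x * y * zeta * (x * y)^-1 * zeta^-1 =
       (x * (y * zeta * y^-1 * zeta^-1) * x^-1) * (x * zeta * x^-1 * zeta^-1).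
      by rewrite !gnorm.
    by apply: LM => //; apply: normal_kernel_conj.
  have -> : x^-1 * zeta * x^-1^-1 * zeta^-1 =
      x^-1 * (x * zeta * x^-1 * zeta^-1)^-1 * x^-1^-1 by rewrite !gnorm.
  by apply/normal_kernel_conj/LV.
have Li := same_square0 iN.
have -> : s i * zeta * (s i)^-1 * zeta^-1 =
  s i * (square i * zeta^-1)^-1 * (s i)^-1 * (square i * zeta^-1).
  by rewrite /square !gnorm.
by apply: LM => //; apply/normal_kernel_conj/LV.
Qed.

Local Notation Z := (span (fun x => x = zeta)).

Definition zeta_kernel z := exists2 c, Z c & L (z * c^-1).

Lemma squares_zeta_kernel z : squares z -> zeta_kernel z.
Proof.
have [L1 LM LV] := normal_kernel_closed.
elim=> {z} [_ [g [i ->]]||x y _ [c Zc Lx] _ [d Zd Ly]|x _ [c Zc Lx]].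
- exists zeta; first exact: span_gen.
  have -> : g * (s i * s i) * g^-1 * zeta^-1 =
    (g * (square i * zeta^-1) * g^-1) * (g * zeta * g^-1 * zeta^-1).
    by rewrite /square !gnorm.
  by apply: LM; [apply/normal_kernel_conj/same_square0
    | apply: zeta_central_mod].
- by exists 1; [exact: span1 | rewrite mulgV].
- exists (c * d); first exact: spanM.
  have -> : x * y * (c * d)^-1 = (x * c^-1) * (c * (y * d^-1) * c^-1).
    by rewrite !gnorm.
  by apply: LM => //; apply: normal_kernel_conj.
exists c^-1; first exact: spanV.
have -> : x^-1 * c^-1^-1 = c^-1 * (x * c^-1)^-1 * c^-1^-1 by rewrite !gnorm.
by apply/normal_kernel_conj/LV.
Qed.

Lemma zeta_power c : Z c -> exists p m, c * zeta ^+ m = zeta ^+ p.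
Proof.
elim=> {c} [_ ->||c d _ [p [m Ec]] _ [p' [m' Ed]]|c _ [p [m Ec]]].
- by exists 1%N, 0%N; rewrite mulg1.
- by exists 0%N, 0%N; rewrite mulg1.
- exists (p + p')%N, (m' + m)%N.
  rewrite expgD mulgA -(mulgA c) Ed -mulgA -expgD addnC expgD mulgA Ec.
  by rewrite expgD.
by exists m, p; rewrite -Ec mulKg.
Qed.

(** By Coxeter's theorem the braid is a power of zeta modulo the kernel; this
    power is in the commutator subgroup, so its exponent sum is 0. *)
Lemma square_kernel (d : braid' n) : natural_map d = 1 -> q d = 1.
Proof.
move=> /(congr1 val) /= /perm_kernel_squares/squares_zeta_kernel[c Zc Lz].
have Dd : D (derived_val d) by apply/asboolP/(derived_valP d).
have Dc : D c.
  have [Dz _] := Lz; have := in_derivedM (in_derivedV Dz) Dd.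
  by rewrite invgM invgK mulgVK.
have c1 : c = 1.
  have d0 : degree_is (s 0) 1 0 by apply: degree_gen; lia.
  have dz k := degreeX k (degreeM d0 d0).
  have [p [m E]] := zeta_power Zc.
  have := degree_unique (degreeM (degree_derived Dc) (dz m)); rewrite E =>
    /(_ _ _ (dz p)) pm.
  by apply: (mulIg (zeta ^+ m)); rewrite E mul1g; congr (_ ^+ _); lia.
rewrite c1 invg1 mulg1 in Lz.
by have [_ /(_ 1)] := Lz; rewrite mul1g invg1 mulg1 qbar_val.
Qed.

End SquareCase.

(** * The natural map and the alternating group *)

Section Cardinality.
Import classical_sets.

Lemma card_gt_at_least (G : groupType) m N : (m < N)%N ->
  at_least (fun _ : G => True) N -> card_gt G m.
Proof.
move=> mN [s [Us Ns] _].
have nth_inj : {in `I_N &, injective (nth 1 s)}.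
  move=> i j; rewrite !inE /= => iN jN /eqP.
  by rewrite nth_uniq // => [/eqP||]; [|apply: leq_trans Ns..].
have leN : (`I_N #<= [set: G])%card.
  by rewrite -(card_le_eql (inj_card_eq nth_inj)); apply: subset_card_le.
split; first by apply: card_le_trans leN; rewrite card_le_II ltnW.
by apply/negP => /card_le_eqr; move/(_ _ `I_N);
  rewrite leN card_le_II leqNgt mN.
Qed.
End Cardinality.

Section Hom.
Variables (G H : groupType) (f : G -> H).
Hypothesis fM : {morph f : x y / x * y}.

Lemma morph_monoid : monoid_morphism f.
Proof.
by split=> //; apply: (mulgI (f 1)); rewrite -fM !mulg1.
Qed.

Lemma hom_of : exists F : group_hom G H, F =1 f.
Proof.
pose mx := isUMagmaMorphism.Build G H f morph_monoid.
pose F : group_hom G H := HB.pack f mx.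
by exists F.
Qed.
End Hom.

Section Natural.
Variable n : nat.
Hypothesis n_gt4 : (4 < n)%N.
Local Notation s := (gen n).

Lemma braid_perm_surj (p : 'S_n) : exists b, braid_perm b = p.
Proof.
have n0 : (0 < n)%N by lia.
pose o := Ordinal n0.
pose I := [set p : 'S_n | `[< exists b, braid_perm b = p >]].
have gI : group_set I.
  apply/group_setP; split=> [|x y].
    by rewrite inE; apply/asboolP; exists 1; apply: gmulf1.
  rewrite !inE => /asboolP[b <-] /asboolP[c <-]; apply/asboolP.
  by exists (b * c); apply: gmulfM.
suff: p \in Group gI by rewrite inE => /asboolP.
have: p \in <<[set tperm o y | y in 'I_n]>> by rewrite gen_tperm inE.
move: p; apply/subsetP; rewrite gen_subG; apply/subsetP=> _ /imsetP[y _ ->].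
case: y => y yn; elim: y yn => [|y IHy] yn.
  by rewrite (_ : Ordinal yn = o) ?tperm1 ?group1 //; apply: val_inj.
have yn' : (y < n)%N by apply: ltnW.
have yN : (y < n.-1)%N by lia.
have E : transposition (Ordinal yN) = tperm (Ordinal yn') (Ordinal yn).
  by congr tperm; apply: val_inj.
have It : tperm (Ordinal yn') (Ordinal yn) \in Group gI.
  by rewrite inE; apply/asboolP; exists (sigma (Ordinal yN));
    rewrite braid_permP.
case: y => [|y] in yn yn' yN E It IHy *.
  by rewrite (_ : o = Ordinal yn') //; apply: val_inj.
rewrite -(_ : tperm o (Ordinal yn') ^ tperm (Ordinal yn') (Ordinal yn) =
  tperm o (Ordinal yn)).
  by rewrite groupJ // IHy.
by rewrite tpermJ tpermD ?tpermL // -val_eqE.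
Qed.

(** The image of P is normalised by A_n and not trivial, so it is A_n, which is
    simple. *)
Lemma natural_image (P : braid' n -> Prop) : gclosed P ->
    (forall d a, P d -> a \in 'Alt_('I_n) ->
       exists2 e, P e & braid_perm (derived_val e) =
         a * braid_perm (derived_val d) * a^-1) ->
  (exists2 d, P d & natural_map d <> 1) ->
  forall a, exists2 d, P d & natural_map d = a.
Proof.
move=> [P1 PM PV] PJ [d0 Pd0 d0N].
pose I := [set p : 'S_n | `[< exists2 d, P d & braid_perm (derived_val d) =
  p >]].
have gI : group_set I.
  apply/group_setP; split=> [|x y].
    by rewrite inE; apply/asboolP; exists 1 => //; rewrite derived_val1;
      apply: gmulf1.
  rewrite !inE => /asboolP[b Pb <-] /asboolP[c Pc <-]; apply/asboolP.
  by exists (b * c); [apply: PM | rewrite derived_valM; apply: gmulfM].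
have IA : Group gI \subset 'Alt_('I_n).
  by apply/subsetP=> p; rewrite inE => /asboolP[d _ <-]; apply: braid_perm_Alt.
have nI : Group gI <| 'Alt_('I_n).
  rewrite /normal IA; apply/subsetP=> p pA; rewrite inE; apply/subsetP=> x.
  rewrite mem_conjg !inE => /asboolP[d Pd dx].
  have [e Pe Ee] := PJ d p^-1 Pd (groupVr pA).
  apply/asboolP; exists e => //.
  by rewrite Ee dx conjgE !invgK mulKg mulgVK.
have sA : simple 'Alt_('I_n) by apply: simple_Alt5; rewrite card_ord.
case/simpleP: sA => _ /(_ _ nI)[I1|IA' a].
  have: braid_perm (derived_val d0) \in Group gI.
    by rewrite inE; apply/asboolP; exists d0.
  rewrite I1 inE => /eqP d1; case: d0N; exact: val_inj.
have: val a \in Group gI by rewrite IA'; apply: valP.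
rewrite inE => /asboolP[d Pd da]; exists d => //; exact: val_inj.
Qed.

(** The image is normal because every permutation lifts to a braid. *)
Lemma natural_map_surj (a : alternating n) : exists d : braid' n, natural_map d
  = a.
Proof.
suff [d _ <-] : exists2 d : braid' n, True & natural_map d = a by exists d.
apply: natural_image => // [d p _ _|].
  have [g <-] := braid_perm_surj p.
  have /derived_ex[e De] : in_derived (g * derived_val d * g^-1).
    exact/derived_conj/asboolP/(derived_valP d).
  by exists e => //; rewrite De !gmulfM gmulfV.
have /derived_ex[e De] : in_derived (s 1 * (s 0)^-1)
  by apply: gen_ratio_derived; lia.
exists e => // /(congr1 val) /=; rewrite De gmulfM gmulfV /= => /divg1_eq E.
have n1 : (1 < n)%N by lia.
have n2 : (2 < n)%N by lia.
have E1 : braid_perm (s 1) (Ordinal n1) = 2 :> nat by apply: perm_gen_val => //;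
  lia.
have E0 : braid_perm (s 0) (Ordinal n2) = Ordinal n2 by apply: perm_gen_lt =>
  //; lia.
have : braid_perm (s 0) (Ordinal n1) = braid_perm (s 0) (Ordinal n2).
  by rewrite E0 -E; apply: val_inj.
by move/perm_inj/(congr1 val).
Qed.

Section Comparison.
Variables (G : groupType) (q : group_hom (braid' n) G).
Hypothesis q_surj : forall g : G, exists b : braid' n, q b = g.
Hypothesis G_nontrivial : exists g : G, g <> 1.
Hypothesis ker_natural : forall d : braid' n, natural_map d = 1 -> q d = 1.

(** Otherwise the kernel of q is mapped onto A_n, so every element of B'_n
    agrees with one in the kernel of q up to the kernel of the natural map, and
    q is trivial. *)
Lemma ker_quotient (d : braid' n) : q d = 1 -> natural_map d = 1.
Proof.
move=> qd; apply: contrapT => dN; have [g gN] := G_nontrivial; apply: gN.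
have [b <-] := q_surj g.
have [] := @natural_image (fun d => q d = 1) _ _ _ (natural_map b).
- split=> [|x y qx qy|x qx]; first exact: gmulf1.
    by rewrite gmulfM qx qy mulg1.
  by rewrite gmulfV qx invg1.
- move=> x a qx aA; have [e Ee] := natural_map_surj (Subg aA).
  exists (e * x * e^-1); first by rewrite !gmulfM gmulfV qx mulg1 mulgV.
  have {}Ee : braid_perm (derived_val e) = a by have := congr1 val Ee.
  have -> : derived_val (e * x * e^-1) = derived_val e * derived_val x *
    (derived_val e)^-1.
    by rewrite !derived_valM; congr (_ * _); apply: valV.
  by rewrite !gmulfM gmulfV /= Ee.
- by exists d.
move=> e qe Ee; have : q (b * e^-1) = 1.
  by apply: ker_natural; rewrite gmulfM gmulfV /= Ee mulgV.
by rewrite gmulfM gmulfV qe invg1 mulg1.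
Qed.

Lemma same_fibres (b c : braid' n) : q b = q c <-> natural_map b =
  natural_map c.
Proof.
split=> E; apply: divg1_eq.
  by rewrite -gmulfV -gmulfM; apply: ker_quotient;
    rewrite gmulfM gmulfV E mulgV.
by rewrite -gmulfV -gmulfM; apply: ker_natural;
  rewrite gmulfM gmulfV /= E mulgV.
Qed.

Lemma quotient_isomorphic : isomorphic G (alternating n).
Proof.
pose f g := natural_map (projT1 (cid (q_surj g))).
have fq b : f (q b) = natural_map b.
  by rewrite /f; case: cid => c /= /same_fibres.
have fM : {morph f : x y / x * y}.
  move=> x y; have [b <-] := q_surj x; have [c <-] := q_surj y.
  by rewrite -gmulfM !fq gmulfM.
have [F Ff] := hom_of fM; exists F.
exists (fun a => q (projT1 (cid (natural_map_surj a)))) => [g|a]; rewrite Ff.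
  have [b <-] := q_surj g; case: cid => c /= cb.
  by apply/same_fibres; rewrite cb fq.
by rewrite fq; case: cid.
Qed.

(** The maps f q and the natural map are onto A_n and have the same fibres. *)
Lemma quotient_automorphism (f : group_hom G (alternating n)) : bijective f ->
  exists2 phi, phi \in Aut [set: alternating n] &
    forall b : braid' n, f (q b) = phi (natural_map b).
Proof.
move=> f_bij; have f_inj := bij_inj f_bij.
pose p a := f (q (projT1 (cid (natural_map_surj a)))).
have pN b : p (natural_map b) = f (q b).
  by rewrite /p; case: cid => c /= /same_fibres ->.
have p_inj : injective p.
  move=> a a'; have [b <-] := natural_map_surj a; have [b' <-] :=
    natural_map_surj a'.
  by rewrite !pN => /f_inj/same_fibres.
exists (perm p_inj) => [|b]; last by rewrite permE pN.
rewrite inE; apply/andP; split; first by apply/subsetP=> a; rewrite !inE.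
apply/morphicP=> a a' _ _; have [b <-] := natural_map_surj a.
have [b' <-] := natural_map_surj a'.
by rewrite !permE -gmulfM !pN !gmulfM.
Qed.
End Comparison.

Theorem quotient_dichotomy (G : groupType) (q : group_hom (braid' n) G) :
    (forall g : G, exists b : braid' n, q b = g) ->
  (exists2 N, (n`! %/ 2 < N)%N & at_least (fun _ : G => True) N) \/
  (forall d : braid' n, natural_map d = 1 -> q d = 1).
Proof.
move=> q_surj; have [x2|x2] := EM (qbar q (braid_X n 0) ^+ 2 = 1).
  by right; apply: square_kernel.
left; have r_gt1 : (1 < n - 3)%N by lia.
have [N NG HN] := large_quotient r_gt1 (quotient_relations q n_gt4)
  (quotient_full n_gt4 q_surj) x2.
exists N => //; rewrite subnK in NG; last by lia.
by rewrite ltn_divLR // mulnC.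
Qed.

End Natural.

Theorem theorem1 (n : nat) (hn : (5 <= n)%N) (G : groupType)
    (q : group_hom (braid' n) G)
    (q_surj : forall g : G, exists b : braid' n, q b = g)
    (G_nontrivial : exists g : G, g <> 1) :
  #|'Alt_('I_n)| = (n`! %/ 2)%N /\
  (card_gt G (n`! %/ 2) \/ isomorphic G (alternating n)) /\
  (forall f : group_hom G (alternating n), bijective f ->
     exists2 phi, phi \in Aut [set: alternating n] &
       forall b : braid' n, f (q b) = phi (natural_map b)).
Proof.
have cardA : #|'Alt_('I_n)| = (n`! %/ 2)%N.
  have := @card_Alt 'I_n; rewrite card_ord => <-; last by lia.
  by rewrite mulKn.
split=> //; split=> [|f f_bij].
  have [[N NG HN]|ker] := quotient_dichotomy hn q_surj.
    by left; apply: card_gt_at_least HN.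
  by right; apply: quotient_isomorphic ker.
have [[N NG [s [Us sN] _]]|ker] := quotient_dichotomy hn q_surj; last first.
  exact: quotient_automorphism ker f f_bij.
have : (N <= n`! %/ 2)%N; last by rewrite leqNgt NG.
rewrite -cardA; apply: leq_trans sN _.
have Uf : uniq (map f s) by rewrite map_inj_uniq //; apply: bij_inj.
rewrite -(size_map f) -(card_uniqP Uf).
have -> : #|'Alt_('I_n)| = #|alternating n| by rewrite card_sub.
exact: max_card.
Qed.
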